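(* There exist universal constants $C,C'>0$ such that the following holds. Let $0<q<1$, $\alpha>0$, and $m,s\in\mathbb{N}$ satisfy $$m\ge C\alpha^{-1}\Big(\frac1q-\frac12\Big)s\log^4(s),$$ and set $N=\lceil s^{(1/q-1/2)/\alpha}\rceil$. Then there exist sampling points $x_1,\dots,x_m\in[-1,1]$ and a reconstruction map $R$ assigning to each vector in $\mathbb{R}^m$ a polynomial of degree at most $N$, such that for every $f\in A_q\cap A_{1,\alpha}$ the polynomial $P=R(f(x_1),\dots,f(x_m))$ satisfies $$\frac{1}{\sqrt3}\|f-P\|_{\infty,w}\le\|f-P\|_{A_1}\le C'\big(\|f\|_{A_q}+\|f\|_{A_{1,\alpha}}\big)s^{1-1/q}.$$
   Context: $L_k$ denotes the Legendre polynomial of degree $k$ normalized so that $\frac12\int_{-1}^1L_kL_\ell\,dx=\delta_{k,\ell}$. For $f\in C[-1,1]$, its Fourier–Legendre coefficients are $c_k(f)=\frac12\int_{-1}^1f(x)L_k(x)\,dx$, $k\in\mathbb{N}_0$, and $c(f)=(c_k(f))_{k\ge0}$. For $0<p\le1$, $A_p=\{f\in C[-1,1]:\|c(f)\|_p<\infty\}$ with $\|f\|_{A_p}=\|c(f)\|_p=(\sum_k|c_k(f)|^p)^{1/p}$. For $\alpha>0$, $A_{1,\alpha}$ is the set of $f\in C[-1,1]$ with $\|f\|_{A_{1,\alpha}}=\sum_{k\ge0}(1+k)^\alpha|c_k(f)|<\infty$. With $w(x)=\sqrt{\pi/2}\,(1-x^2)^{1/4}$, $\|f\|_{\infty,w}=\sup_{x\in[-1,1]}|f(x)|w(x)$.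 *)

(* Defs.v *)
From Stdlib Require Import Reals Lra.
From Coquelicot Require Import Coquelicot.
Open Scope R_scope.

(* Real power with the convention 0^p = 0 (p > 0); Stdlib's Rpower 0 p = 1. *)
Definition rpow (a p : R) : R := if Req_EM_T a 0 then 0 else Rpower a p.

(* (P_n(x), P_{n+1}(x)) for the classical Legendre polynomials, via
   (n+2) P_{n+2} = (2n+3) x P_{n+1} - (n+1) P_n. *)
Fixpoint leg_pair (n : nat) (x : R) : R * R :=
  match n with
  | O => (1, x)
  | S n' => let (a, b) := leg_pair n' x in
            (b, ((2 * INR n' + 3) * x * b - (INR n' + 1) * a) / (INR n' + 2))
  end.

(* Normalized Legendre polynomial: (1/2) int_{-1}^1 L_k L_l = delta_{kl}. *)
Definition L (k : nat) (x : R) : R := sqrt (2 * INR k + 1) * fst (leg_pair k x).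

Definition cont_on_I (f : R -> R) : Prop :=
  forall x, -1 <= x <= 1 -> forall eps, 0 < eps -> exists delta, 0 < delta /\
    forall y, -1 <= y <= 1 -> Rabs (y - x) < delta -> Rabs (f y - f x) < eps.

Definition coef (f : R -> R) (k : nat) : R :=
  / 2 * RInt (fun x => f x * L k x) (-1) 1.

Definition in_Ap (p : R) (f : R -> R) : Prop :=
  cont_on_I f /\ ex_series (fun k => rpow (Rabs (coef f k)) p).
Definition norm_Ap (p : R) (f : R -> R) : R :=
  rpow (Series (fun k => rpow (Rabs (coef f k)) p)) (/ p).

Definition norm_A1 (f : R -> R) : R := Series (fun k => Rabs (coef f k)).

Definition in_A1alpha (alpha : R) (f : R -> R) : Prop :=
  cont_on_I f /\ ex_series (fun k => Rpower (1 + INR k) alpha * Rabs (coef f k)).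
Definition norm_A1alpha (alpha : R) (f : R -> R) : R :=
  Series (fun k => Rpower (1 + INR k) alpha * Rabs (coef f k)).

Definition w (x : R) : R := sqrt (PI / 2) * sqrt (sqrt (1 - x ^ 2)).

Definition norm_inf_w (g : R -> R) : Rbar :=
  Lub_Rbar (fun y => exists x, -1 <= x <= 1 /\ y = Rabs (g x) * w x).

Definition poly_eval (N : nat) (a : nat -> R) (x : R) : R :=
  sum_f_R0 (fun k => a k * x ^ k) N.

(* Main.v *)
Require Import Defs.
From Stdlib Require Import Arith Reals List Lra Lia Psatz Classical ClassicalEpsilon FunctionalExtensionality.
From Coquelicot Require Import Coquelicot.
Open Scope R_scope.

(* The functions w L_k are orthonormal for the Chebyshev measure and, by Bernstein's inequality,
   bounded by sqrt 3; a continuous f with summable coefficients satisfies w f = sum c_k w L_k.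
   Some choice of m sampling points satisfies, for all coefficient vectors c up to degree N,
   avg (w sum c_k L_k)^2 >= a |c|_2^2 - b |c|_1^2 / s. No random measure is needed: each step
   of the probabilistic argument (Chernoff bounds over finite nets of Maurey averages) is
   replaced by choosing points one at a time so as not to increase an exponential potential.
   This inequality bounds |c|_1 by the error of best 2s-term approximation plus sqrt s times
   the largest weighted sample. From the data, reconstruct with the truncated Legendre series
   of a function of nearly minimal norm among those with the same weighted samples: its
   difference with f is nearly sparse by Stechkin's estimate, and has small samples because
   both tails beyond degree N are at most N^(-alpha) <= s^(1/2-1/q). If s^((1/q-1/2)/alpha) <= 2,
   the sample at 0 already suffices, with a constant reconstruction. *)

(** * Sums over lists and derandomised sampling *)

(** The obstacle is that the Maurey average replacing [c] must be accurate on the sample, which is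
    fixed before [c]. All averages form a finite net known in advance, and the sample is chosen to
    hit the level sets of every member of the net. Only afterwards is a member picked that is close
    to [c] at most points of the reference set and of the sample together. The scales balance: where
    the form has square about [2^-i], an average needs about [2^i] terms up to logarithms, so the
    logarithm of the net size grows like [2^i]; but a level set may then be missed if its measure is
    below about [2^i / (s log s)]. Expected hits and entropy grow at the same rate, and one sample
    size serves all levels. Only a lower bound enters, because the samples of a difference of two
    candidates are bounded pointwise by their tails. *)

Definition lsum {A : Type} (l : list A) (f : A -> R) : R :=
  fold_right (fun a acc => f a + acc) 0 l.

Lemma lsum_ext {A} (l : list A) f g :
  (forall a, In a l -> f a = g a) -> lsum l f = lsum l g.
Proof.
  induction l as [|a l IH]; intros H; simpl; auto.
  rewrite (H a (or_introl eq_refl)), IH; auto. intros b Hb; apply H; now right.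
Qed.

Lemma lsum_le {A} (l : list A) f g :
  (forall a, In a l -> f a <= g a) -> lsum l f <= lsum l g.
Proof.
  induction l as [|a l IH]; intros H; simpl; [lra|].
  apply Rplus_le_compat; [apply H; now left | apply IH; intros; apply H; now right].
Qed.

Lemma lsum_plus {A} (l : list A) f g :
  lsum l (fun a => f a + g a) = lsum l f + lsum l g.
Proof. induction l as [|a l IH]; simpl; [lra|rewrite IH; lra]. Qed.

Lemma lsum_minus {A} (l : list A) f g :
  lsum l (fun a => f a - g a) = lsum l f - lsum l g.
Proof. induction l as [|a l IH]; simpl; [lra|rewrite IH; lra]. Qed.

Lemma lsum_scal {A} (l : list A) f c :
  lsum l (fun a => c * f a) = c * lsum l f.
Proof. induction l as [|a l IH]; simpl; [lra|rewrite IH; lra]. Qed.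

Lemma lsum_const {A} (l : list A) c : lsum l (fun _ => c) = INR (length l) * c.
Proof.
  induction l as [|a l IH]; simpl lsum; [simpl; lra|].
  simpl length; rewrite S_INR, IH; lra.
Qed.

Lemma lsum_nonneg {A} (l : list A) f :
  (forall a, In a l -> 0 <= f a) -> 0 <= lsum l f.
Proof.
  intros H. replace 0 with (lsum l (fun _ => 0)) by (rewrite lsum_const; lra).
  now apply lsum_le.
Qed.

Lemma lsum_zero {A} (l : list A) f :
  (forall a, In a l -> f a = 0) -> lsum l f = 0.
Proof.
  intros H. rewrite (lsum_ext l f (fun _ => 0) H), lsum_const; lra.
Qed.

Lemma lsum_abs {A} (l : list A) f : Rabs (lsum l f) <= lsum l (fun a => Rabs (f a)).
Proof.
  induction l as [|a l IH]; simpl; [rewrite Rabs_R0; lra|].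
  eapply Rle_trans; [apply Rabs_triang|lra].
Qed.

Lemma lsum_app {A} (l1 l2 : list A) f : lsum (l1 ++ l2) f = lsum l1 f + lsum l2 f.
Proof. induction l1 as [|a l IH]; simpl; [lra|rewrite IH; lra]. Qed.

Lemma lsum_map {A B} (l : list A) (g : A -> B) f :
  lsum (map g l) f = lsum l (fun a => f (g a)).
Proof. induction l as [|a l IH]; simpl; [lra|rewrite IH; lra]. Qed.

Lemma lsum_flat_map {A B} (l : list A) (g : A -> list B) f :
  lsum (flat_map g l) f = lsum l (fun a => lsum (g a) f).
Proof. induction l as [|a l IH]; simpl; [lra|rewrite lsum_app, IH; lra]. Qed.

Lemma lsum_swap {A B} (l1 : list A) (l2 : list B) f :
  lsum l1 (fun a => lsum l2 (fun b => f a b)) = lsum l2 (fun b => lsum l1 (fun a => f a b)).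
Proof.
  induction l1 as [|a l IH]; simpl.
  - now rewrite lsum_zero.
  - now rewrite IH, lsum_plus.
Qed.

Lemma lsum_seq_S n f : lsum (seq 0 (S n)) f = lsum (seq 0 n) f + f n.
Proof. rewrite seq_S, lsum_app; simpl; lra. Qed.

Lemma lsum_term_le {A} (l : list A) f a :
  (forall b, In b l -> 0 <= f b) -> In a l -> f a <= lsum l f.
Proof.
  induction l as [|b l IH]; intros H Ha; [easy|]; simpl.
  destruct Ha as [->|Ha].
  - assert (0 <= lsum l f) by (apply lsum_nonneg; intros; apply H; now right). lra.
  - assert (f a <= lsum l f) by (apply IH; auto; intros; apply H; now right).
    pose proof (H b (or_introl eq_refl)). lra.
Qed.

Lemma lsum_cauchy_schwarz {A} (l : list A) f g :
  Rsqr (lsum l (fun a => f a * g a)) <= lsum l (fun a => f a ^ 2) * lsum l (fun a => g a ^ 2).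
Proof.
  set (P := lsum l (fun a => f a ^ 2)). set (Q := lsum l (fun a => g a ^ 2)).
  set (B := lsum l (fun a => f a * g a)).
  assert (HP : 0 <= P) by (apply lsum_nonneg; intros; apply pow2_ge_0).
  assert (HQ : 0 <= Q) by (apply lsum_nonneg; intros; apply pow2_ge_0).
  assert (H : forall t u, 0 <= t ^ 2 * P + 2 * t * u * B + u ^ 2 * Q).
  { intros t u.
    replace (t ^ 2 * P + 2 * t * u * B + u ^ 2 * Q)
      with (lsum l (fun a => (t * f a + u * g a) ^ 2)).
    - apply lsum_nonneg; intros; apply pow2_ge_0.
    - unfold P, Q, B. rewrite <- !lsum_scal, <- !lsum_plus. apply lsum_ext; intros; ring. }
  unfold Rsqr. destruct (Req_dec P 0) as [P0|P0].
  - destruct (Req_dec B 0) as [->|B0]; [nra|].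
    specialize (H (- (Q + 1)) B). rewrite P0 in H.
    assert (0 < B * B) by nra. nra.
  - specialize (H (- B) P). assert (0 < P) by lra. nra.
Qed.

(* Derandomised product measure: if the p-average of each [exp (h j)] is at most
   [rho j], choosing the points one at a time keeps the potential below its expectation. *)
Lemma exists_below_expectation {X J : Type} (Xs : list X) (p : X -> R) (Js : list J)
    (h : J -> X -> R) (rho : J -> R) (m : nat) :
  (forall x, In x Xs -> 0 <= p x) -> lsum Xs p = 1 ->
  (forall j, In j Js -> lsum Xs (fun x => p x * exp (h j x)) <= rho j) ->
  forall v : J -> R, (forall j, In j Js -> 0 <= v j) ->
  exists xs, length xs = m /\ incl xs Xs /\
    lsum Js (fun j => v j * exp (lsum xs (h j))) <= lsum Js (fun j => v j * rho j ^ m).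
Proof.
  intros Hp Hp1 Hrho.
  assert (Hrho0 : forall j, In j Js -> 0 <= rho j).
  { intros j Hj. eapply Rle_trans; [|apply Hrho; auto].
    apply lsum_nonneg; intros x Hx. apply Rmult_le_pos; [auto|left; apply exp_pos]. }
  induction m as [|m IH]; intros v Hv.
  - exists nil; repeat split; auto; [intros ? []|].
    apply lsum_le; intros; simpl; rewrite exp_0; lra.
  (* [F x] is the conditional expectation after a first point [x], with the remaining [m] points
     replaced by the bound [rho j ^ m]. Its [p]-average is at most the target, so some [x] does not
     exceed it. *)
  - set (F := fun x => lsum Js (fun j => v j * exp (h j x) * rho j ^ m)).
    assert (HF : lsum Xs (fun x => p x * F x) <= lsum Js (fun j => v j * rho j ^ S m)).
    { unfold F.
      rewrite (lsum_ext Xs _ (fun x => lsum Js (fun j => v j * rho j ^ m * (p x * exp (h j x))))).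
      2:{ intros x _. rewrite <- lsum_scal. apply lsum_ext; intros; ring. }
      rewrite lsum_swap. apply lsum_le; intros j Hj.
      rewrite lsum_scal. simpl.
      replace (v j * (rho j * rho j ^ m)) with (v j * rho j ^ m * rho j) by ring.
      apply Rmult_le_compat_l; [|auto].
      apply Rmult_le_pos; [auto|apply pow_le; auto]. }
    destruct (classic (exists x, In x Xs /\ F x <= lsum Js (fun j => v j * rho j ^ S m)))
      as [(x & Hx & Hle)|Hno].
    + destruct (IH (fun j => v j * exp (h j x))) as (xs & Hl & Hi & Hs).
      { intros j Hj. apply Rmult_le_pos; [auto|left; apply exp_pos]. }
      exists (x :: xs); repeat split; simpl; [congruence|now apply incl_cons|].
      eapply Rle_trans; [|exact Hle]. unfold F.
      eapply Rle_trans; [|exact Hs].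
      apply lsum_le; intros j Hj. rewrite exp_plus; lra.
    + exfalso.
      set (B := lsum Js (fun j => v j * rho j ^ S m)) in *.
      assert (HB : forall x, In x Xs -> B < F x).
      { intros x Hx. apply Rnot_le_lt; intros H; apply Hno; eauto. }
      assert (Hd : 0 < lsum Xs (fun x => p x * (F x - B))).
      (* Total mass one is relaxed to positive mass, which survives the removal of a point of weight
         zero in the induction on [Xs]. *)
      { clear HF IH Hno Hrho.
        assert (Hp1' : 0 < lsum Xs p) by lra. clear Hp1. revert Hp Hp1' HB. clear.
        induction Xs as [|x Xs IH]; intros Hp H1 HB; simpl in *; [lra|].
        assert (HxB := HB x (or_introl eq_refl)).
        assert (Hpx := Hp x (or_introl eq_refl)).
        assert (0 <= lsum Xs (fun x => p x * (F x - B))).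
        { apply lsum_nonneg; intros z Hz. pose proof (HB z (or_intror Hz)).
          apply Rmult_le_pos; [apply Hp; now right|lra]. }
        destruct (Req_dec (p x) 0) as [E|E].
        - rewrite E in *.
          assert (0 < lsum Xs (fun x => p x * (F x - B))); [|lra].
          apply IH; [intros; apply Hp; now right|lra|intros; apply HB; now right].
        - assert (0 < p x * (F x - B)) by (apply Rmult_lt_0_compat; lra). lra. }
      rewrite (lsum_ext Xs _ (fun x => p x * F x - B * p x)) in Hd by (intros; ring).
      rewrite lsum_minus, lsum_scal, Hp1 in Hd. lra.
Qed.

Definition indic (P : Prop) : R := if excluded_middle_informative P then 1 else 0.

Lemma indic_true (P : Prop) : P -> indic P = 1.
Proof. unfold indic; destruct excluded_middle_informative; tauto. Qed.

Lemma indic_false (P : Prop) : ~ P -> indic P = 0.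
Proof. unfold indic; destruct excluded_middle_informative; tauto. Qed.

Lemma indic_bounds (P : Prop) : 0 <= indic P <= 1.
Proof. unfold indic; destruct excluded_middle_informative; lra. Qed.

Definition avg {X} (l : list X) (f : X -> R) : R := lsum l f / INR (length l).

Lemma length_pos_of_not_nil {X} (l : list X) : l <> nil -> 0 < INR (length l).
Proof. destruct l; intros H; [easy|]. apply lt_0_INR; simpl; lia. Qed.

Lemma exp_neg_ln2 : exp (- ln 2) = / 2.
Proof. rewrite exp_Ropp, exp_ln; lra. Qed.

(** A one-sided Chernoff bound for all events at once: the average of [2 ^ (- indic)] is
    [1 - mu / 2 <= exp (- mu / 2)]. An event of measure below [theta j] asks for nothing, and
    [theta] pays for the union bound. The final potential is at most 1, hence so is each of its
    terms. *)
Lemma exists_sample_hitting {X J : Type} (Om : list X) (Js : list J) (E : J -> X -> Prop)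
    (theta : J -> R) (m : nat) :
  Om <> nil ->
  lsum Js (fun j => exp (- (ln 2 / 2 * INR m * theta j))) <= 1 ->
  exists xs, length xs = m /\ incl xs Om /\
    forall j, In j Js ->
      INR m * (avg Om (fun x => indic (E j x)) - theta j) / 2 <= lsum xs (fun x => indic (E j x)).
Proof.
  intros HOm Hsum. set (M := INR (length Om)).
  assert (HM : 0 < M) by now apply length_pos_of_not_nil.
  set (mu := fun j => avg Om (fun x => indic (E j x))).
  assert (Hln : 0 < ln 2) by (rewrite <- ln_1; apply ln_increasing; lra).
  (* With this [v j], a term of the final potential is 2 to the power of required hits minus actual
     hits; [ln 2 <= 1] bounds the initial term by [exp (- (ln 2 / 2 * INR m * theta j))]. *)
  destruct (exists_below_expectation Om (fun _ => / M) Js (fun j x => - ln 2 * indic (E j x))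
              (fun j => 1 - mu j / 2) m) with
    (v := fun j => exp (ln 2 * (INR m * (mu j - theta j) / 2))) as (xs & Hl & Hi & Hs).
  - intros; left; now apply Rinv_0_lt_compat.
  - rewrite lsum_const; fold M; field; lra.
  - intros j _.
    rewrite (lsum_ext Om _ (fun x => / M - / 2 * (/ M * indic (E j x)))).
    2:{ intros x _. unfold indic; destruct excluded_middle_informative.
        - rewrite Rmult_1_r, exp_neg_ln2; lra.
        - rewrite Rmult_0_r, exp_0; lra. }
    rewrite lsum_minus, lsum_const, !lsum_scal. unfold mu, avg; fold M.
    right; field; lra.
  - intros; left; apply exp_pos.
  - exists xs; repeat split; auto. intros j Hj.
    assert (Hmu : forall j, 0 <= mu j <= 1).
    { intros i; unfold mu, avg; fold M; split.
      - apply Rmult_le_pos; [apply lsum_nonneg; intros; apply indic_bounds|left; now apply Rinv_0_lt_compat].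
      - apply Rmult_le_reg_r with M; [lra|]. unfold Rdiv; rewrite Rmult_assoc, Rinv_l by lra.
        rewrite Rmult_1_r, Rmult_1_l. unfold M.
        rewrite <- (Rmult_1_r (INR _)), <- lsum_const. apply lsum_le; intros; apply indic_bounds. }
    assert (H1 : lsum Js (fun j => exp (ln 2 * (INR m * (mu j - theta j) / 2)) * (1 - mu j / 2) ^ m) <= 1).
    { eapply Rle_trans; [|exact Hsum]. apply lsum_le; intros i _.
      assert (Hpow : (1 - mu i / 2) ^ m <= exp (- (mu i / 2) * INR m)).
      { rewrite Rmult_comm, <- (Rpower_pow m) by (specialize (Hmu i); lra).
        unfold Rpower.
        destruct (Hmu i).
        assert (ln (1 - mu i / 2) <= - (mu i / 2)).
        { replace (- (mu i / 2)) with (ln (exp (- (mu i / 2)))) by apply ln_exp.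
          apply ln_le; [lra|]. pose proof (exp_ineq1_le (- (mu i / 2))); lra. }
        destruct (Rle_lt_or_eq_dec (INR m * ln (1 - mu i / 2)) (INR m * - (mu i / 2))) as [|E'].
        - apply Rmult_le_compat_l; [apply pos_INR|auto].
        - left; now apply exp_increasing.
        - rewrite E'; lra. }
      eapply Rle_trans; [apply Rmult_le_compat_l; [left; apply exp_pos|exact Hpow]|].
      rewrite <- exp_plus.
      assert (Hle : ln 2 * (INR m * (mu i - theta i) / 2) + - (mu i / 2) * INR m
                    <= - (ln 2 / 2 * INR m * theta i)).
      { pose proof (pos_INR m). destruct (Hmu i). pose proof ln_lt_2.
        assert (ln 2 <= 1).
        { rewrite <- (ln_exp 1). apply ln_le; [lra|]. pose proof (exp_ineq1_le 1); lra. }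
        assert (0 <= INR m * mu i) by (apply Rmult_le_pos; lra). nra. }
      destruct Hle as [Hlt|Heq]; [left; now apply exp_increasing|rewrite Heq; lra]. }
    assert (H2 : exp (ln 2 * (INR m * (mu j - theta j) / 2)) * exp (lsum xs (fun x => - ln 2 * indic (E j x))) <= 1).
    { eapply Rle_trans; [|exact H1]. eapply Rle_trans; [|exact Hs].
      apply (lsum_term_le Js (fun j => exp (ln 2 * (INR m * (mu j - theta j) / 2)) *
        exp (lsum xs (fun x => - ln 2 * indic (E j x))))); auto.
      intros; left; apply Rmult_lt_0_compat; apply exp_pos. }
    rewrite <- exp_plus, lsum_scal in H2.
    assert (H3 : ln 2 * (INR m * (mu j - theta j) / 2) + - ln 2 * lsum xs (fun a => indic (E j a)) <= 0).
    { apply Rnot_lt_le; intros H. apply exp_increasing in H. rewrite exp_0 in H. lra. }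
    fold (mu j). nra.
Qed.

(** * Maurey averages and the restricted lower bound *)

Lemma exp_le_mono x y : x <= y -> exp x <= exp y.
Proof. intros [H|H]; [left; now apply exp_increasing|rewrite H; lra]. Qed.

Lemma exp_quadratic_bound x : Rabs x <= / 2 -> exp x <= 1 + x + 2 * x ^ 2.
Proof.
  intros H. apply Rabs_le_between in H.
  assert (H1 : 1 - x <= exp (- x)) by (pose proof (exp_ineq1_le (- x)); lra).
  assert (H2 : exp x * exp (- x) = 1) by (rewrite <- exp_plus, Rplus_opp_r; apply exp_0).
  pose proof (exp_pos x).
  assert (H3 : exp x * (1 - x) <= 1) by nra.
  assert (H4 : 1 <= (1 + x + 2 * x ^ 2) * (1 - x)).
  { replace ((1 + x + 2 * x ^ 2) * (1 - x)) with (1 + x ^ 2 * (1 - 2 * x)) by ring.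
    pose proof (pow2_ge_0 x). nra. }
  apply Rmult_le_reg_r with (1 - x); lra.
Qed.

(** The vertices of the l1 unit ball, coded as index and sign; a vector of l1 norm one is a convex
    combination of them. *)
Definition signed (n : nat) : list (nat * R) :=
  flat_map (fun k => (k, 1) :: (k, -1) :: nil) (seq 0 n).

Lemma length_signed n : length (signed n) = (2 * n)%nat.
Proof.
  unfold signed. rewrite (flat_map_constant_length (c := 2%nat)), length_seq; [lia|reflexivity].
Qed.

Lemma in_signed n k s : (k < n)%nat -> s = 1 \/ s = -1 -> In (k, s) (signed n).
Proof.
  intros Hk Hs. apply in_flat_map. exists k; split; [apply in_seq; lia|].
  simpl; intuition congruence.
Qed.

Fixpoint tuples {G} (l : list G) (d : nat) : list (list G) :=
  match d with
  | O => nil :: nil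
  | S d => flat_map (fun g => map (cons g) (tuples l d)) l
  end.

Lemma length_tuples {G} (l : list G) d : length (tuples l d) = (length l ^ d)%nat.
Proof.
  induction d as [|d IH]; [reflexivity|]. simpl.
  rewrite (flat_map_constant_length (c := (length l ^ d)%nat)); [lia|].
  intros; now rewrite length_map.
Qed.

Lemma in_tuples {G} (l : list G) ks : incl ks l -> In ks (tuples l (length ks)).
Proof.
  induction ks as [|g ks IH]; intros H; simpl; [now left|].
  apply in_flat_map. exists g; split; [apply H; now left|].
  apply in_map, IH. intros x Hx; apply H; now right.
Qed.

Section Sampling.

Context {X : Type} (a : X -> nat -> R) (n : nat).

Definition form (c : nat -> R) (x : X) : R := lsum (seq 0 n) (fun k => c k * a x k).

Definition l1 (c : nat -> R) : R := lsum (seq 0 n) (fun k => Rabs (c k)).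

(** The unnormalised Maurey average: it is compared with [INR ell * form c x]. *)
Definition tuple_form (ks : list (nat * R)) (x : X) : R :=
  lsum ks (fun g => snd g * a x (fst g)).

Lemma form_bound c x b :
  (forall k, (k < n)%nat -> Rabs (a x k) <= b) -> Rabs (form c x) <= b * l1 c.
Proof.
  intros Hb. unfold form, l1. eapply Rle_trans; [apply lsum_abs|].
  rewrite <- lsum_scal. apply lsum_le; intros k Hk. apply in_seq in Hk.
  rewrite Rabs_mult. specialize (Hb k ltac:(lia)). pose proof (Rabs_pos (c k)). nra.
Qed.

(** Maurey's empirical method, derandomised: [ell] vertices are drawn with probabilities
    [Rabs (c k)] and the signs of [c k], so that the mean of a drawn entry is [form c x]. Accuracy
    is asked up to bad points of small mass, so [ell] does not depend on the size of [Z]. *)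
Lemma maurey_approximation (Z : list (X * R)) c tau ell :
  (forall z, In z Z -> 0 <= snd z) ->
  (forall z k, In z Z -> (k < n)%nat -> Rabs (a (fst z) k) <= 2) ->
  l1 c = 1 -> 0 < tau <= 8 ->
  exists ks, length ks = ell /\ incl ks (signed n) /\
    lsum Z (fun z => snd z *
      indic (INR ell * tau < Rabs (tuple_form ks (fst z) - INR ell * form c (fst z))))
    <= 2 * lsum Z snd * exp (- (INR ell * tau ^ 2 / 128)).
Proof.
  intros Hv Hb Hc Htau.
  set (sg := fun k => if Rle_dec 0 (c k) then 1 else -1).
  assert (Hsg : forall k, Rabs (c k) * sg k = c k).
  { intros k; unfold sg. destruct Rle_dec; [rewrite Rabs_pos_eq by lra; lra|].
    rewrite Rabs_left by lra; lra. }
  assert (Hsg1 : forall k, sg k = 1 \/ sg k = -1).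
  { intros k; unfold sg; destruct Rle_dec; auto. }
  set (Xs := map (fun k => (k, sg k)) (seq 0 n)).
  (* Centred entries are at most 4 in absolute value, so [lam <= 1/8] brings the exponents within
     the range of [exp_quadratic_bound]; each draw costs a factor [exp (32 * lam ^ 2)]. *)
  set (lam := tau / 64).
  set (h := fun (j : (X * R) * R) (g : nat * R) =>
              lam * snd j * (snd g * a (fst (fst j)) (fst g) - form c (fst (fst j)))).
  set (Js := flat_map (fun z => (z, 1) :: (z, -1) :: nil) Z).
  assert (HJ : forall j, In j Js -> In (fst j) Z /\ (snd j = 1 \/ snd j = -1)).
  { intros j Hj. apply in_flat_map in Hj as (z & Hz & [<-|[<-|[]]]); simpl; auto. }
  destruct (exists_below_expectation Xs (fun g => Rabs (c (fst g))) Js h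
              (fun _ => exp (32 * lam ^ 2)) ell) with (v := fun j : (X * R) * R => snd (fst j))
    as (ks & Hl & Hi & Hs).
  - intros; apply Rabs_pos.
  - unfold Xs; rewrite lsum_map; exact Hc.
  - intros j Hj. apply HJ in Hj as [Hj Hs].
    set (x := fst (fst j)) in *. unfold Xs; rewrite lsum_map; simpl.
    assert (Hf : Rabs (form c x) <= 2).
    { pose proof (form_bound c x 2 (fun k => Hb (fst j) k Hj)). lra. }
    set (y := fun k => sg k * a x k - form c x).
    assert (Hy : forall k, (k < n)%nat -> Rabs (y k) <= 4).
    { intros k Hk. unfold y. eapply Rle_trans; [apply Rabs_triang|].
      rewrite Rabs_Ropp, Rabs_mult.
      assert (Rabs (sg k) = 1) by (destruct (Hsg1 k) as [->| ->]; [apply Rabs_R1|rewrite Rabs_left; lra]).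
      rewrite H, Rmult_1_l. pose proof (Hb (fst j) k Hj Hk). fold x in H0. lra. }
    apply Rle_trans with
      (lsum (seq 0 n) (fun k => (1 + 32 * lam ^ 2) * Rabs (c k) + lam * snd j * (Rabs (c k) * y k))).
    + apply lsum_le; intros k Hk. apply in_seq in Hk. unfold h; simpl. fold x. fold (y k).
      specialize (Hy k ltac:(lia)).
      assert (Hy2 : y k ^ 2 <= 16).
      { rewrite <- (pow2_abs (y k)). pose proof (Rabs_pos (y k)). nra. }
      assert (Hx : Rabs (lam * snd j * y k) <= / 2).
      { rewrite !Rabs_mult. rewrite (Rabs_pos_eq lam) by (unfold lam; lra).
        assert (Rabs (snd j) = 1) by (destruct Hs as [->| ->]; [apply Rabs_R1|rewrite Rabs_left; lra]).
        rewrite H. unfold lam. nra. }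
      apply exp_quadratic_bound in Hx.
      assert (Hsq : (lam * snd j * y k) ^ 2 <= lam ^ 2 * 16).
      { replace ((lam * snd j * y k) ^ 2) with (lam ^ 2 * y k ^ 2)
          by (destruct Hs as [->| ->]; ring).
        pose proof (pow2_ge_0 lam). nra. }
      pose proof (Rabs_pos (c k)). nra.
    + rewrite lsum_plus, !lsum_scal.
      replace (lsum (seq 0 n) (fun k => Rabs (c k) * y k)) with 0.
      2:{ unfold y. rewrite (lsum_ext _ _ (fun k => c k * a x k - form c x * Rabs (c k))).
          - rewrite lsum_minus, lsum_scal. fold (l1 c). rewrite Hc. fold (form c x). lra.
          - intros k _. rewrite <- (Hsg k) at 2. ring. }
      fold (l1 c). rewrite Hc. pose proof (exp_ineq1_le (32 * lam ^ 2)) as He. simpl pow in *. lra.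
  - intros j Hj. apply Hv, HJ, Hj.
  - exists ks; repeat split; auto.
    { intros g Hg. apply Hi in Hg. apply in_map_iff in Hg as (k & <- & Hk).
      apply in_seq in Hk. apply in_signed; [lia|auto]. }
    assert (Hexp : exp (32 * lam ^ 2) ^ ell = exp (INR ell * (tau ^ 2 / 128))).
    { rewrite <- (Rpower_pow ell) by apply exp_pos. unfold Rpower. rewrite ln_exp.
      f_equal. unfold lam. field. }
    rewrite (lsum_ext Js (fun j => snd (fst j) * exp (32 * lam ^ 2) ^ ell)
      (fun j => exp (INR ell * (tau ^ 2 / 128)) * snd (fst j))) in Hs.
    2:{ intros; rewrite Hexp; ring. }
    unfold Js in Hs. rewrite lsum_scal, !lsum_flat_map in Hs. simpl in Hs.
    rewrite (lsum_ext Z (fun z => snd z + (snd z + 0)) (fun z => 2 * snd z)), lsum_scal in Hs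
      by (intros; ring).
    (* Markov's inequality: a bad point contributes at least [exp K] times its weight, while the
       potential is at most [exp (K / 2)] times twice the total mass. *)
    set (K := INR ell * tau ^ 2 / 64).
    apply Rmult_le_reg_l with (exp K); [apply exp_pos|].
    replace (exp K * (2 * lsum Z snd * exp (- (INR ell * tau ^ 2 / 128))))
      with (exp (INR ell * (tau ^ 2 / 128)) * (2 * lsum Z snd)).
    2:{ replace (INR ell * (tau ^ 2 / 128)) with (K + - (INR ell * tau ^ 2 / 128))
          by (unfold K; field).
        rewrite exp_plus; ring. }
    eapply Rle_trans; [|exact Hs].
    rewrite <- lsum_scal. apply lsum_le; intros z Hz.
    specialize (Hv z Hz). set (D := tuple_form ks (fst z) - INR ell * form c (fst z)).
    assert (HD : forall s, lsum ks (h (z, s)) = lam * s * D).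
    { intros s. unfold h; simpl. rewrite lsum_scal, lsum_minus, lsum_const, Hl. reflexivity. }
    rewrite !HD.
    assert (Hmain : exp K * indic (INR ell * tau < Rabs D) <= exp (lam * 1 * D) + exp (lam * -1 * D)).
    { pose proof (exp_pos (lam * 1 * D)). pose proof (exp_pos (lam * -1 * D)).
      unfold indic; destruct excluded_middle_informative as [Hbad|]; [|lra].
      assert (HK : K = lam * (INR ell * tau)) by (unfold K, lam; field).
      assert (0 < lam) by (unfold lam; lra).
      unfold Rabs in Hbad. destruct Rcase_abs.
      - assert (exp K <= exp (lam * -1 * D)); [|lra]. apply exp_le_mono. rewrite HK. nra.
      - assert (exp K <= exp (lam * 1 * D)); [|lra]. apply exp_le_mono. rewrite HK. nra. }
    fold D. nra.
Qed.

(** * Dyadic levels and the lower bound on the sample *)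

Definition level (i : nat) : R := 2 * (/ 2) ^ i.

Lemma level_pos i : 0 < level i.
Proof. unfold level. pose proof (pow_lt (/ 2) i). lra. Qed.

(** The first level below [u] is at least [u / 2], since levels halve and [u <= 4 = 2 * level 0]; if
    none of the [d] levels lies below [u], the last term covers it. *)
Lemma le_sum_levels u d : u <= 4 ->
  u <= lsum (seq 0 d) (fun i => 2 * level i * indic (level i < u)) + 4 * (/ 2) ^ d.
Proof.
  intros H4. induction d as [|d IH]; [simpl; lra|].
  rewrite lsum_seq_S.
  assert (Hpos : 0 <= lsum (seq 0 d) (fun i => 2 * level i * indic (level i < u))).
  { apply lsum_nonneg; intros i _. pose proof (level_pos i).
    apply Rmult_le_pos; [lra|apply indic_bounds]. }
  assert (Hd : 4 * (/ 2) ^ d = 2 * level d) by (unfold level; ring).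
  assert (Hd' : 4 * (/ 2) ^ S d = level d) by (unfold level; simpl; field).
  pose proof (level_pos d). rewrite Hd'. rewrite Hd in IH.
  unfold indic at 2; destruct excluded_middle_informative; lra.
Qed.

Lemma sum_levels_le u d : 0 <= u ->
  lsum (seq 0 d) (fun i => level i * indic (level i <= 4 * u)) <= 8 * u.
Proof.
  intros Hu.
  (* The invariant keeps [2 * level d] in reserve, the sum of all levels from [d] on. *)
  assert (H : lsum (seq 0 d) (fun i => level i * indic (level i <= 4 * u)) = 0 \/
    lsum (seq 0 d) (fun i => level i * indic (level i <= 4 * u)) + 2 * level d <= 8 * u).
  { induction d as [|d IH]; [now left|].
    rewrite lsum_seq_S.
    assert (Hd' : 2 * level (S d) = level d) by (unfold level; simpl; field).
    pose proof (level_pos d). rewrite Hd'.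
    unfold indic at 2 4; destruct excluded_middle_informative; [right|]; lra. }
  pose proof (level_pos d). lra.
Qed.

Lemma avg_indic_le (l : list X) (P Q B : X -> Prop) :
  (forall x, In x l -> P x -> ~ B x -> Q x) ->
  avg l (fun x => indic (P x)) <= avg l (fun x => indic (Q x)) + avg l (fun x => indic (B x)).
Proof.
  intros H. unfold avg, Rdiv. rewrite <- Rmult_plus_distr_r, <- lsum_plus.
  destruct l as [|x0 l]; [simpl; lra|].
  apply Rmult_le_compat_r.
  { left; apply Rinv_0_lt_compat, length_pos_of_not_nil; discriminate. }
  apply lsum_le; intros x Hx.
  pose proof (indic_bounds (Q x)). pose proof (indic_bounds (B x)).
  destruct (classic (P x)) as [HP|HP]; [|rewrite (indic_false _ HP); lra].
  rewrite (indic_true _ HP).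
  destruct (classic (B x)) as [HB|HB]; [rewrite (indic_true _ HB); lra|].
  rewrite (indic_true (Q x)); [lra|auto].
Qed.

Lemma avg_le (l : list X) f g :
  (forall x, In x l -> f x <= g x) -> avg l f <= avg l g.
Proof.
  intros H. destruct l as [|x0 l]; [unfold avg; simpl; lra|].
  apply Rmult_le_compat_r; [|now apply lsum_le].
  left; apply Rinv_0_lt_compat, length_pos_of_not_nil; discriminate.
Qed.

Lemma avg_lsum {A} (l : list X) (s : list A) (b : A -> R) (f : A -> X -> R) :
  avg l (fun x => lsum s (fun i => b i * f i x)) = lsum s (fun i => b i * avg l (f i)).
Proof.
  unfold avg, Rdiv. rewrite lsum_swap, Rmult_comm, <- lsum_scal.
  apply lsum_ext; intros. rewrite lsum_scal; ring.
Qed.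

Lemma pow_INR_2 k : INR (2 ^ k) = 2 ^ k.
Proof. rewrite pow_INR; reflexivity. Qed.

Lemma sum_half_pow d : lsum (seq 0 d) (fun i => (/ 2) ^ S i) = 1 - (/ 2) ^ d.
Proof.
  induction d as [|d IH]; [simpl; lra|]. rewrite lsum_seq_S, IH. simpl; field.
Qed.

Lemma exp_ln2_INR k : exp (INR k * ln 2) = 2 ^ k.
Proof. rewrite <- Rpower_pow by lra. reflexivity. Qed.

Lemma half_pow_inv k : (/ 2) ^ k = / 2 ^ k.
Proof. apply pow_inv. Qed.

(* Row values are sliced into the levels [form c x ^ 2 > level i]. On level i the linear
   form is replaced by one of the (2n)^(2^i * 1024 * (J+2)) Maurey averages; there are few
   enough of them at the coarse scales for the sample to hit all their level sets. *)
Lemma restricted_lower_bound (Om : list X) (J h m : nat) :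
  Om <> nil ->
  (forall x k, In x Om -> (k < n)%nat -> Rabs (a x k) <= 2) ->
  (2 * n <= 2 ^ h)%nat ->
  (2 * 2 ^ J * (J + 2) * (1024 * h * (J + 2) + 1) <= m)%nat ->
  exists xs, length xs = m /\ incl xs Om /\
    forall c, avg Om (fun x => form c x ^ 2) / 32 - l1 c ^ 2 / 2 ^ J
              <= avg xs (fun x => form c x ^ 2).
Proof.
  intros HOm Ha Hh Hm.
  (* With this many levels the remainder [4 / 2 ^ d] is [1 / 2 ^ J]. *)
  set (d := (J + 2)%nat) in *.
  (* For the deviation [sqrt (level i) / 4] the Maurey exponent [ell * tau ^ 2 / 128] equals [d] at
     every level. *)
  set (ell := fun i => (2 ^ i * 1024 * d)%nat).
  (* The measure that may be missed; [level i * theta i] is the same for all [i] and sums to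
     [2 / 2 ^ J]. *)
  set (theta := fun i => 2 ^ i / (2 ^ J * INR d)).
  (* The factor 3/4 lies midway between 1/2 and 1: a deviation of a quarter of [sqrt (level i)]
     carries [level i < form ^ 2] into [E], and [E] into [level i <= 4 * form ^ 2]. *)
  set (E := fun (j : nat * list (nat * R)) x =>
              3 / 4 * INR (ell (fst j)) * sqrt (level (fst j)) <= Rabs (tuple_form (snd j) x)).
  set (Js := flat_map (fun i => map (pair i) (tuples (signed n) (ell i))) (seq 0 d)).
  assert (H2J : 0 < 2 ^ J) by (apply pow_lt; lra).
  assert (Hd : 2 <= INR d) by (unfold d; rewrite plus_INR; pose proof (pos_INR J); simpl; lra).
  assert (Hln : 0 < ln 2) by (rewrite <- ln_1; apply ln_increasing; lra).
  assert (HmR : 2 * 2 ^ J * INR d * (1024 * INR h * INR d + 1) <= INR m).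
  { apply le_INR in Hm. rewrite !mult_INR, plus_INR, !mult_INR, pow_INR_2 in Hm.
    rewrite (INR_IZR_INZ 1024) in Hm. simpl in Hm. lra. }
  assert (Hm0 : 0 < INR m).
  { eapply Rlt_le_trans; [|exact HmR]. pose proof (pos_INR h).
    assert (0 <= 1024 * INR h * INR d) by (apply Rmult_le_pos; lra).
    repeat apply Rmult_lt_0_compat; lra. }
  destruct (exists_sample_hitting Om Js E (fun j => theta (fst j)) m HOm) as (xs & Hl & Hi & Hs).
  (* Union bound: all averages of level [i] together contribute at most [2 ^ -(i + 1)]. *)
  { unfold Js. rewrite lsum_flat_map.
    apply Rle_trans with (lsum (seq 0 d) (fun i => (/ 2) ^ S i)).
    2:{ rewrite sum_half_pow. pose proof (pow_lt (/ 2) d). lra. }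
    apply lsum_le; intros i _. rewrite lsum_map. simpl fst. rewrite lsum_const, length_tuples, length_signed.
    assert (Hcount : INR ((2 * n) ^ ell i) <= exp (INR (h * ell i) * ln 2)).
    { rewrite exp_ln2_INR, <- pow_INR_2. apply le_INR.
      rewrite Nat.pow_mul_r. now apply Nat.pow_le_mono_l. }
    eapply Rle_trans; [apply Rmult_le_compat_r; [left; apply exp_pos|exact Hcount]|].
    rewrite <- exp_plus, half_pow_inv, <- exp_ln2_INR, <- exp_Ropp.
    apply exp_le_mono.
    assert (Hi2 : INR (S i) <= 2 ^ i).
    { rewrite <- pow_INR_2. apply le_INR. pose proof (Nat.pow_gt_lin_r 2 i). lia. }
    assert (H2i : 0 < 2 ^ i) by (apply pow_lt; lra).
    assert (Hth : 2 ^ i * (1024 * INR h * INR d + 1) <= / 2 * INR m * theta i).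
    { unfold theta.
      apply Rmult_le_reg_r with (2 * 2 ^ J * INR d); [repeat apply Rmult_lt_0_compat; lra|].
      replace (/ 2 * INR m * (2 ^ i / (2 ^ J * INR d)) * (2 * 2 ^ J * INR d))
        with (2 ^ i * INR m) by (field; lra).
      rewrite Rmult_assoc. apply Rmult_le_compat_l; lra. }
    assert (Hell : INR (h * ell i) = 2 ^ i * (1024 * INR h * INR d)).
    { unfold ell. rewrite !mult_INR, pow_INR_2, (INR_IZR_INZ 1024). simpl. ring. }
    rewrite Hell. nra. }
  exists xs; repeat split; auto.
  assert (Hxs : xs <> nil) by (intros ->; simpl in Hl; rewrite <- Hl in Hm0; simpl in Hm0; lra).
  assert (HM : 0 < INR (length Om)) by now apply length_pos_of_not_nil.
  assert (Hunit : forall c, l1 c = 1 ->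
     avg Om (fun x => form c x ^ 2) / 32 - / 2 ^ J <= avg xs (fun x => form c x ^ 2)).
  { intros c Hc.
    assert (Hlev : forall i, In i (seq 0 d) ->
      (avg Om (fun x => indic (level i < form c x ^ 2)) - theta i) / 2 - / 2 ^ J
      <= avg xs (fun x => indic (level i <= 4 * form c x ^ 2))).
    { intros i Hid.
      pose proof (level_pos i) as Hlp.
      assert (HT : 0 < sqrt (level i)) by now apply sqrt_lt_R0.
      assert (HT2 : sqrt (level i) ^ 2 = level i) by (apply pow2_sqrt; lra).
      assert (Hlev2 : level i <= 2).
      { unfold level. assert ((/ 2) ^ i <= 1); [|lra]. rewrite <- (pow1 i). apply pow_incr; lra. }
      assert (Hell0 : 0 < INR (ell i)).
      { apply lt_0_INR. unfold ell, d. pose proof (Nat.pow_nonzero 2 i). nia. }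
      (* [Om] and the sample enter as one weighted family of total mass 2, so one average serves
         both, with bad mass at most [4 * exp (- d) <= 1 / 2 ^ J]. It may depend on [xs], since
         every average was covered when [xs] was chosen. *)
      destruct (maurey_approximation
        (map (fun x => (x, / INR (length Om))) Om ++ map (fun x => (x, / INR m)) xs)
        c (sqrt (level i) / 4) (ell i)) as (ks & Hkl & Hki & Hks).
      - intros z Hz. apply in_app_iff in Hz as [Hz|Hz]; apply in_map_iff in Hz as (x & <- & _);
          left; simpl; now apply Rinv_0_lt_compat.
      - intros z k Hz Hk. apply in_app_iff in Hz as [Hz|Hz]; apply in_map_iff in Hz as (x & <- & Hx);
          simpl; apply Ha; auto.
      - exact Hc.
      - nra.
      - set (B := fun x => INR (ell i) * (sqrt (level i) / 4)
                           < Rabs (tuple_form ks x - INR (ell i) * form c x)).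
        assert (Hbad : avg Om (fun x => indic (B x)) + avg xs (fun x => indic (B x)) <= / 2 ^ J).
        { rewrite !lsum_app, !lsum_map in Hks. simpl in Hks.
          rewrite !lsum_const, !lsum_scal, Hl in Hks. fold B in Hks.
          change (lsum Om (fun a0 => indic (INR (ell i) * (sqrt (level i) / 4) <
            Rabs (tuple_form ks a0 - INR (ell i) * form c a0))))
            with (lsum Om (fun x => indic (B x))) in Hks.
          change (lsum xs (fun a0 => indic (INR (ell i) * (sqrt (level i) / 4) <
            Rabs (tuple_form ks a0 - INR (ell i) * form c a0))))
            with (lsum xs (fun x => indic (B x))) in Hks.
          unfold avg, Rdiv. rewrite Hl, !(Rmult_comm (lsum _ _)).
          eapply Rle_trans; [exact Hks|].
          rewrite !Rinv_r by lra.
          replace (INR (ell i) * (sqrt (level i) / 4 * (sqrt (level i) / 4 * 1)) / 128)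
            with (INR d).
          2:{ replace (sqrt (level i) / 4 * (sqrt (level i) / 4 * 1)) with (level i / 16)
                by (transitivity (sqrt (level i) ^ 2 / 16); [now rewrite HT2|field]).
              unfold ell, level. rewrite !mult_INR, pow_INR_2, (INR_IZR_INZ 1024), half_pow_inv.
              simpl. field. apply pow_nonzero; lra. }
          assert (He : exp (- INR d) <= / 4 * / 2 ^ J).
          { replace (/ 4 * / 2 ^ J) with (exp (- (INR d * ln 2))).
            - apply exp_le_mono.
              assert (ln 2 <= 1); [|nra].
              rewrite <- (ln_exp 1). apply ln_le; [lra|]. pose proof (exp_ineq1_le 1); lra.
            - rewrite exp_Ropp, exp_ln2_INR. unfold d. rewrite pow_add. simpl. field. lra. }
          lra. }
        assert (HE : (avg Om (fun x => indic (E (i, ks) x)) - theta i) / 2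
                     <= avg xs (fun x => indic (E (i, ks) x))).
        { unfold avg at 2. rewrite Hl.
          apply Rmult_le_reg_r with (INR m); [lra|].
          unfold Rdiv at 2. rewrite Rmult_assoc, Rinv_l, Rmult_1_r by lra.
          eapply Rle_trans; [|apply (Hs (i, ks))].
          - simpl fst. right; field.
          - apply in_flat_map. exists i; split; auto. apply in_map.
            rewrite <- Hkl. now apply in_tuples. }
        assert (Hsq : forall y, y ^ 2 = Rabs y ^ 2) by (intros; symmetry; apply pow2_abs).
        assert (HV : avg Om (fun x => indic (level i < form c x ^ 2)) <=
                     avg Om (fun x => indic (E (i, ks) x)) + avg Om (fun x => indic (B x))).
        { apply avg_indic_le; intros x _ HVx HBx. unfold E; simpl fst; simpl snd.
          apply Rnot_lt_le in HBx.
          assert (sqrt (level i) < Rabs (form c x)).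
          { rewrite Hsq in HVx. pose proof (Rabs_pos (form c x)). nra. }
          assert (HR : Rabs (INR (ell i) * form c x) <=
            Rabs (tuple_form ks x - INR (ell i) * form c x) + Rabs (tuple_form ks x)).
          { rewrite <- (Rabs_Ropp (tuple_form ks x - _)).
            eapply Rle_trans; [|apply Rabs_triang]. right; f_equal; ring. }
          rewrite Rabs_mult, (Rabs_pos_eq (INR (ell i))) in HR by lra. nra. }
        assert (HW : avg xs (fun x => indic (E (i, ks) x)) <=
                     avg xs (fun x => indic (level i <= 4 * form c x ^ 2)) + avg xs (fun x => indic (B x))).
        { apply avg_indic_le; intros x _ HEx HBx. unfold E in HEx; simpl fst in HEx; simpl snd in HEx.
          apply Rnot_lt_le in HBx.
          assert (HR : Rabs (tuple_form ks x) <=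
            Rabs (tuple_form ks x - INR (ell i) * form c x) + Rabs (INR (ell i) * form c x)).
          { eapply Rle_trans; [|apply Rabs_triang]. right; f_equal; ring. }
          rewrite Rabs_mult, (Rabs_pos_eq (INR (ell i))) in HR by lra.
          assert (sqrt (level i) / 2 <= Rabs (form c x)).
          { apply Rmult_le_reg_l with (INR (ell i)); lra. }
          rewrite Hsq, <- HT2. nra. }
        assert (0 <= avg Om (fun x => indic (B x))).
        { apply Rmult_le_pos; [apply lsum_nonneg; intros; apply indic_bounds|].
          left; now apply Rinv_0_lt_compat. }
        lra. }
    assert (Hup : avg Om (fun x => form c x ^ 2) <=
      2 * lsum (seq 0 d) (fun i => level i * avg Om (fun x => indic (level i < form c x ^ 2))) + / 2 ^ J).
    { assert (H4 : 4 * (/ 2) ^ d = / 2 ^ J).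
      { rewrite half_pow_inv. unfold d. rewrite pow_add. simpl. field. lra. }
      eapply Rle_trans.
      - apply (avg_le Om _ (fun x => lsum (seq 0 d)
          (fun i => 2 * level i * indic (level i < form c x ^ 2)) + / 2 ^ J)).
        intros x Hx. rewrite <- H4. apply le_sum_levels.
        pose proof (form_bound c x 2 (fun k => Ha x k Hx)) as Hb. rewrite Hc in Hb.
        rewrite <- pow2_abs. pose proof (Rabs_pos (form c x)). nra.
      - unfold avg at 1. rewrite lsum_plus, lsum_const.
        unfold Rdiv; rewrite Rmult_plus_distr_r.
        fold (Rdiv (lsum Om (fun x => lsum (seq 0 d)
          (fun i => 2 * level i * indic (level i < form c x ^ 2)))) (INR (length Om))).
        change (lsum Om ?f / INR (length Om)) with (avg Om f).
        rewrite (avg_lsum Om (seq 0 d) (fun i => 2 * level i)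
          (fun i x => indic (level i < form c x ^ 2))).
        rewrite <- lsum_scal.
        rewrite (lsum_ext (seq 0 d) (fun i => 2 * level i * avg Om (fun x => indic (level i < form c x ^ 2)))
         (fun i => 2 * (level i * avg Om (fun x => indic (level i < form c x ^ 2))))) by (intros; ring).
        right. field. split; lra. }
    assert (Hlow : lsum (seq 0 d) (fun i => level i * avg xs (fun x => indic (level i <= 4 * form c x ^ 2)))
                   <= 8 * avg xs (fun x => form c x ^ 2)).
    { rewrite <- (avg_lsum xs (seq 0 d) level (fun i x => indic (level i <= 4 * form c x ^ 2))).
      eapply Rle_trans.
      - apply (avg_le xs _ (fun x => 8 * form c x ^ 2)). intros; apply sum_levels_le, pow2_ge_0.
      - unfold avg. rewrite lsum_scal. right; unfold Rdiv; ring. }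
    (* The final factor 1/32 is 1/2 from the hits, 1/2 from [Hup] and 1/8 from [Hlow]; the losses
       add up to less than [1 / 2 ^ J]. *)
    assert (Hsum : lsum (seq 0 d) (fun i => level i *
        ((avg Om (fun x => indic (level i < form c x ^ 2)) - theta i) / 2 - / 2 ^ J))
      <= lsum (seq 0 d) (fun i => level i * avg xs (fun x => indic (level i <= 4 * form c x ^ 2)))).
    { apply lsum_le; intros i Hid. apply Rmult_le_compat_l; [left; apply level_pos|auto]. }
    rewrite (lsum_ext _ _ (fun i =>
      / 2 * (level i * avg Om (fun x => indic (level i < form c x ^ 2)))
      - / 2 * (2 / (2 ^ J * INR d)) - 4 * / 2 ^ J * (/ 2) ^ S i)) in Hsum.
    2:{ intros i _. unfold theta, level. simpl. rewrite half_pow_inv. field.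
        repeat split; try lra. apply pow_nonzero; lra. }
    rewrite !lsum_minus, !lsum_scal, lsum_const, length_seq, sum_half_pow in Hsum.
    replace (/ 2 * (INR d * (2 / (2 ^ J * INR d)))) with (/ 2 ^ J) in Hsum by (field; lra).
    assert (0 < / 2 ^ J) by now apply Rinv_0_lt_compat.
    assert (0 < (/ 2) ^ d) by (apply pow_lt; lra).
    pose proof (Rmult_lt_0_compat _ _ H H0). lra. }
  intros c. destruct (Req_dec (l1 c) 0) as [Hc|Hc].
  - rewrite Hc.
    assert (H0 : avg Om (fun x => form c x ^ 2) <= avg Om (fun _ => 0)).
    { apply avg_le; intros x Hx. pose proof (form_bound c x 2 (fun k => Ha x k Hx)) as Hb.
      rewrite Hc in Hb. rewrite <- pow2_abs. pose proof (Rabs_pos (form c x)). nra. }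
    assert (H1 : avg xs (fun _ => 0) <= avg xs (fun x => form c x ^ 2)).
    { apply avg_le; intros; apply pow2_ge_0. }
    unfold avg in H0 at 2. unfold avg in H1 at 1. rewrite lsum_const in H0, H1.
    unfold Rdiv in *. rewrite !Rmult_0_r, Rmult_0_l in *. lra.
  - assert (Hl1 : 0 < l1 c).
    { assert (0 <= l1 c) by (apply lsum_nonneg; intros; apply Rabs_pos). lra. }
    assert (Hform : forall x, form c x ^ 2 = l1 c ^ 2 * form (fun k => / l1 c * c k) x ^ 2).
    { intros x. unfold form.
      rewrite (lsum_ext (seq 0 n) (fun k => / l1 c * c k * a x k) (fun k => / l1 c * (c k * a x k)))
        by (intros; ring).
      rewrite lsum_scal. field; lra. }
    assert (Havg : forall l : list X, avg l (fun x => form c x ^ 2) =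
      l1 c ^ 2 * avg l (fun x => form (fun k => / l1 c * c k) x ^ 2)).
    { intros l. unfold avg. rewrite (lsum_ext l _ _ (fun x _ => Hform x)), lsum_scal. unfold Rdiv; ring. }
    rewrite !Havg.
    specialize (Hunit (fun k => / l1 c * c k)).
    assert (H1 : l1 (fun k => / l1 c * c k) = 1).
    { unfold l1 at 1. rewrite (lsum_ext _ _ (fun k => / l1 c * Rabs (c k))).
      - rewrite lsum_scal. fold (l1 c). field; lra.
      - intros; rewrite Rabs_mult, Rabs_pos_eq; auto. left; now apply Rinv_0_lt_compat. }
    specialize (Hunit H1). pose proof (pow_lt (l1 c) 2 Hl1). unfold Rdiv in *. nra.
Qed.

End Sampling.

(** * Legendre polynomials *)

Ltac as_R := match goal with |- ?a = ?b => change (@eq R a b) end.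

Definition leg (n : nat) (x : R) : R := fst (leg_pair n x).

Lemma leg_pair_leg n x : leg_pair n x = (leg n x, leg (S n) x).
Proof.
  unfold leg. rewrite (surjective_pairing (leg_pair n x)). f_equal.
  simpl. destruct (leg_pair n x); reflexivity.
Qed.

Lemma leg_rec n x :
  (INR n + 2) * leg (S (S n)) x = (2 * INR n + 3) * x * leg (S n) x - (INR n + 1) * leg n x.
Proof.
  unfold leg at 1. simpl. rewrite (leg_pair_leg n x). simpl.
  pose proof (pos_INR n). field. lra.
Qed.

(** The derivative of [leg n], through the recurrence [P'_{n+1} = x P'_n + (n+1) P_n];
    [is_derive_leg] justifies the name. *)
Fixpoint dleg (n : nat) (x : R) : R :=
  match n with
  | O => 0
  | S n => x * dleg n x + (INR n + 1) * leg n x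
  end.

Lemma dleg_S n x : dleg (S n) x = x * dleg n x + (INR n + 1) * leg n x.
Proof. reflexivity. Qed.

Lemma dleg_down n x : x * dleg (S n) x - dleg n x = (INR n + 1) * leg (S n) x.
Proof.
  induction n as [|n IH].
  - simpl; unfold leg; simpl; ring.
  - pose proof (leg_rec n x) as Hr.
    rewrite (dleg_S (S n)), (S_INR n).
    assert (Hx : x * (x * dleg (S n) x) = x * (dleg n x + (INR n + 1) * leg (S n) x)).
    { f_equal. lra. }
    pose proof (dleg_S n x). replace (INR n + 1 + 1) with (INR n + 2) by ring.
    rewrite Hr. lra.
Qed.

Lemma is_derive_leg n x : is_derive (leg n) x (dleg n x).
Proof.
  enough (H : is_derive (leg n) x (dleg n x) /\ is_derive (leg (S n)) x (dleg (S n) x)) by apply H.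
  induction n as [|n [IH1 IH2]].
  - split.
    + unfold leg; simpl. apply @is_derive_const.
    + apply (is_derive_ext (fun x => x)); [reflexivity|].
      simpl; unfold leg; simpl. replace (x * 0 + (0 + 1) * 1) with 1 by ring. apply @is_derive_id.
  - split; auto.
    pose proof (pos_INR n).
    apply (is_derive_ext (fun x => ((2 * INR n + 3) * x * leg (S n) x - (INR n + 1) * leg n x) / (INR n + 2))).
    { intros t. rewrite <- leg_rec. as_R. field. lra. }
    replace (dleg (S (S n)) x) with
      (((2 * INR n + 3) * (leg (S n) x + x * dleg (S n) x) - (INR n + 1) * dleg n x) / (INR n + 2)).
    + auto_derive.
      * repeat split; eexists; eassumption.
      * rewrite (is_derive_unique (fun t : R => leg n t) _ _ IH1), (is_derive_unique (fun t : R => leg (S n) t) _ _ IH2). field. lra.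
    + pose proof (dleg_down n x) as Hd. rewrite (dleg_S (S n)), S_INR.
      replace (dleg n x) with (x * dleg (S n) x - (INR n + 1) * leg (S n) x) by lra.
      field. lra.
Qed.

Lemma dleg_ode n x : (1 - x ^ 2) * dleg (S n) x = (INR n + 1) * (leg n x - x * leg (S n) x).
Proof. pose proof (dleg_down n x). pose proof (dleg_S n x). nra. Qed.

(** Legendre's equation in self-adjoint form, the common source of the orthogonality and of Sonin's
    monotonicity. *)
Lemma is_derive_leg_ode n x :
  is_derive (fun t => (1 - t ^ 2) * dleg n t) x (- (INR n * (INR n + 1) * leg n x)).
Proof.
  destruct n as [|n].
  - simpl. apply (is_derive_ext (fun _ => 0)); [intros; as_R; ring|].
    replace (- _) with 0 by ring. apply @is_derive_const.
  - apply (is_derive_ext (fun t => (INR n + 1) * (leg n t - t * leg (S n) t))).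
    { intros; symmetry; apply dleg_ode. }
    pose proof (is_derive_leg n x) as H1. pose proof (is_derive_leg (S n) x) as H2.
    auto_derive; [repeat split; eexists; eassumption|].
    rewrite (is_derive_unique (fun t : R => leg n t) _ _ H1), (is_derive_unique (fun t : R => leg (S n) t) _ _ H2), S_INR.
    pose proof (dleg_down n x). nra.
Qed.

Lemma continuous_leg n x : continuous (leg n) x.
Proof. apply (ex_derive_continuous (leg n)). eexists; apply is_derive_leg. Qed.

Lemma continuous_dleg n x : continuous (dleg n) x.
Proof.
  induction n as [|n IH]; [apply continuous_const|].
  apply (continuous_ext (fun x => x * dleg n x + (INR n + 1) * leg n x)); [reflexivity|].
  apply @continuous_plus.
  - apply @continuous_mult; [apply continuous_id|exact IH].
  - apply @continuous_mult; [apply continuous_const|apply continuous_leg].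
Qed.

Lemma continuous_legendre k x : continuous (L k) x.
Proof. apply @continuous_mult; [apply continuous_const|apply continuous_leg]. Qed.

Lemma leg_at_0_even_odd n : leg n 0 * leg (S n) 0 = 0.
Proof.
  induction n as [|n IH]; [unfold leg; simpl; ring|].
  pose proof (leg_rec n 0). pose proof (pos_INR n).
  assert (leg (S (S n)) 0 = - ((INR n + 1) / (INR n + 2)) * leg n 0).
  { apply Rmult_eq_reg_l with (INR n + 2); [|lra]. rewrite H. field. lra. }
  rewrite H1, Rmult_comm, Rmult_assoc, IH. ring.
Qed.

(** The quantity does not increase from [n] to [n+2], because [(n+3)(n+1) <= (n+2)^2]. It vanishes
    at [n = 1] and equals 3/4 at [n = 2]. *)
Lemma leg_at_0_bound n : (1 <= n)%nat -> (INR n + 1) * leg n 0 ^ 2 <= 3 / 4.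
Proof.
  intros Hn.
  assert (H2 : forall k, leg (S (S k)) 0 = - ((INR k + 1) / (INR k + 2)) * leg k 0).
  { intros k. pose proof (leg_rec k 0). pose proof (pos_INR k).
    apply Rmult_eq_reg_l with (INR k + 2); [|lra]. rewrite H. field. lra. }
  enough (H : (INR n + 1) * leg n 0 ^ 2 <= 3 / 4 /\ (INR (S n) + 1) * leg (S n) 0 ^ 2 <= 3 / 4) by apply H.
  destruct n as [|n]; [lia|]. clear Hn.
  induction n as [|n [IH1 IH2]].
  - rewrite (H2 0%nat). unfold leg; simpl. split; lra.
  - split; auto. rewrite (H2 (S n)).
    rewrite (S_INR (S (S n))), (S_INR (S n)) in *. set (t := INR (S n)) in *.
    assert (Ht : 1 <= t) by (unfold t; rewrite S_INR; pose proof (pos_INR n); lra).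
    replace ((t + 1 + 1 + 1) * (- ((t + 1) / (t + 2)) * leg (S n) 0) ^ 2)
      with (((t + 1 + 1 + 1) * (t + 1) / (t + 2) ^ 2) * ((t + 1) * leg (S n) 0 ^ 2))
      by (field; lra).
    assert ((t + 1 + 1 + 1) * (t + 1) / (t + 2) ^ 2 <= 1).
    { apply Rmult_le_reg_r with ((t + 2) ^ 2); [nra|]. field_simplify; nra. }
    assert (0 <= (t + 1 + 1 + 1) * (t + 1) / (t + 2) ^ 2).
    { apply Rmult_le_pos; [nra|]. left; apply Rinv_0_lt_compat; nra. }
    assert (0 <= (t + 1) * leg (S n) 0 ^ 2) by (apply Rmult_le_pos; [lra|apply pow2_ge_0]). nra.
Qed.

(* Sonin's function of u(theta) = sqrt (sin theta) * P_n (cos theta), which solves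
   u'' + phi u = 0 with phi = ((2n+1)^2 sin^2 theta + 1) / (4 sin^2 theta); it is
   u^2 + u'^2 / phi written in x = cos theta, and is largest at x = 0. *)
Definition sonin (n : nat) (x : R) : R :=
  sqrt (1 - x ^ 2) * (leg n x ^ 2 +
    (x * leg n x - 2 * ((1 - x ^ 2) * dleg n x)) ^ 2 / ((2 * INR n + 1) ^ 2 * (1 - x ^ 2) + 1)).

(** For [u'' + phi u = 0] the derivative of [u^2 + u'^2 / phi] is [- u'^2 phi' / phi^2]; in the
    variable [x] this is [-x] times a nonnegative quantity. *)
Lemma is_derive_sonin n x : -1 < x < 1 ->
  is_derive (sonin n) x
    (- (2 * x * (x * leg n x - 2 * ((1 - x ^ 2) * dleg n x)) ^ 2
        / (sqrt (1 - x ^ 2) * ((2 * INR n + 1) ^ 2 * (1 - x ^ 2) + 1) ^ 2))).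
Proof.
  intros Hx. assert (Hs : 0 < 1 - x ^ 2) by nra.
  assert (Hq : 0 < sqrt (1 - x ^ 2)) by now apply sqrt_lt_R0.
  assert (Hq2 : sqrt (1 - x ^ 2) ^ 2 = 1 - x ^ 2) by (apply pow2_sqrt; lra).
  pose proof (is_derive_leg n x) as H1. pose proof (is_derive_leg_ode n x) as H2.
  assert (HD : 0 < (2 * INR n + 1) ^ 2 * (1 - x ^ 2) + 1).
  { assert (0 <= (2 * INR n + 1) ^ 2) by apply pow2_ge_0. nra. }
  unfold sonin. set (v := fun t => (1 - t ^ 2) * dleg n t) in *.
  apply (is_derive_ext (fun t => sqrt (1 - t ^ 2) * (leg n t ^ 2 +
    (t * leg n t - 2 * v t) ^ 2 / ((2 * INR n + 1) ^ 2 * (1 - t ^ 2) + 1)))); [reflexivity|].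
  change ((1 - x ^ 2) * dleg n x) with (v x).
  auto_derive.
  - repeat split; try (eexists; eassumption); simpl in *; lra.
  - rewrite (is_derive_unique (fun t : R => leg n t) _ _ H1), (is_derive_unique (fun t : R => v t) _ _ H2).
    replace (dleg n x) with (v x / (1 - x ^ 2)) by (unfold v; field; lra).
    set (p := leg n x). set (vx := v x).
    replace (1 + - (x * (x * 1))) with (1 - x ^ 2) by ring.
    set (S := sqrt (1 - x ^ 2)) in *.
    assert (HS : x ^ 2 = 1 - S ^ 2) by lra.
    set (A := (2 * INR n + 1)) in *.
    replace (INR n) with ((A - 1) / 2) by (unfold A; field).
    (* Factoring out [1 / S] leaves a rational identity in which the square root occurs only through
       [S ^ 2 = 1 - x ^ 2]. *)
    match goal with |- ?a * / (2 * S) * ?E1 + S * ?E2 = - (?T / (S * ?D)) =>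
      assert (HE : a / 2 * E1 + (1 - x ^ 2) * E2 = - (T / D));
      [|transitivity ((a / 2 * E1 + S ^ 2 * E2) / S);
        [field; simpl in *; lra|rewrite Hq2, HE; field; split; [simpl in *; lra|lra]]]
    end.
    field. split; simpl in *; lra.
Qed.

Lemma sonin_le n x : -1 < x < 1 -> sonin n x <= sonin n 0.
Proof.
  intros Hx.
  destruct (Req_dec x 0) as [->|Hx0]; [lra|].
  assert (Hd : forall t, Rmin x 0 <= t <= Rmax x 0 -> -1 < t < 1).
  { intros t. unfold Rmin, Rmax; destruct Rle_dec; lra. }
  destruct (MVT_gen (sonin n) x 0 (fun t => - (2 * t * (t * leg n t - 2 * ((1 - t ^ 2) * dleg n t)) ^ 2
        / (sqrt (1 - t ^ 2) * ((2 * INR n + 1) ^ 2 * (1 - t ^ 2) + 1) ^ 2)))) as (t & Ht & He).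
  - intros t Ht. apply is_derive_sonin, Hd; lra.
  - intros t Ht. apply continuity_pt_filterlim. apply (ex_derive_continuous (sonin n)).
    eexists; apply is_derive_sonin, Hd; lra.
  - assert (Hs : 0 <= (t * leg n t - 2 * ((1 - t ^ 2) * dleg n t)) ^ 2
        / (sqrt (1 - t ^ 2) * ((2 * INR n + 1) ^ 2 * (1 - t ^ 2) + 1) ^ 2)).
    { apply Hd in Ht. assert (0 < 1 - t ^ 2) by nra.
      apply Rmult_le_pos; [apply pow2_ge_0|]. left; apply Rinv_0_lt_compat.
      apply Rmult_lt_0_compat; [now apply sqrt_lt_R0|]. apply pow_lt.
      pose proof (pow2_ge_0 (2 * INR n + 1)). nra. }
    set (K := (t * leg n t - 2 * ((1 - t ^ 2) * dleg n t)) ^ 2 / _) in Hs.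
    assert (Htx : 0 <= t * x).
    { unfold Rmin, Rmax in Ht; destruct (Rle_dec x 0); nra. }
    assert (He' : sonin n 0 - sonin n x = 2 * (t * x) * K).
    { rewrite He. unfold K, Rdiv. ring. }
    assert (0 <= t * x * K) by now apply Rmult_le_pos. lra.
Qed.

(** The square is [(2k+1) * PI / 2 * sqrt (1 - x^2) * P_k(x)^2], which is dominated through the
    Sonin function by its value at 0. As [PI <= 4], it remains to show
    [(2k+1) * sonin k 0 <= 3/2]. *)
Lemma weighted_legendre_bound k x : -1 <= x <= 1 -> Rabs (w x * L k x) <= sqrt 3.
Proof.
  intros Hx. apply Rsqr_incr_0_var; [|apply sqrt_pos].
  rewrite <- Rsqr_abs, Rsqr_sqrt by lra.
  assert (H0 : 0 <= 1 - x ^ 2) by nra.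
  assert (Hw : Rsqr (w x * L k x) = (2 * INR k + 1) * (PI / 2) * (sqrt (1 - x ^ 2) * leg k x ^ 2)).
  { unfold w, L. fold (leg k x). rewrite !Rsqr_mult, !Rsqr_sqrt; unfold Rsqr; try ring.
    - pose proof (pos_INR k); lra.
    - apply sqrt_pos.
    - pose proof PI_RGT_0; lra. }
  rewrite Hw.
  pose proof PI_RGT_0. pose proof PI_4. pose proof (pos_INR k) as Hk0.
  enough (Hmain : (2 * INR k + 1) * (sqrt (1 - x ^ 2) * leg k x ^ 2) <= 3 / 2) by nra.
  destruct (Req_dec (1 - x ^ 2) 0) as [E|E]; [rewrite E, sqrt_0; lra|].
  assert (Hx' : -1 < x < 1) by nra.
  assert (Hson : sqrt (1 - x ^ 2) * leg k x ^ 2 <= sonin k x).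
  { unfold sonin. apply Rmult_le_compat_l; [apply sqrt_pos|].
    assert (0 <= (x * leg k x - 2 * ((1 - x ^ 2) * dleg k x)) ^ 2 / ((2 * INR k + 1) ^ 2 * (1 - x ^ 2) + 1)).
    { apply Rmult_le_pos; [apply pow2_ge_0|]. left; apply Rinv_0_lt_compat.
      pose proof (pow2_ge_0 (2 * INR k + 1)). nra. }
    lra. }
  assert (Hs0 : (2 * INR k + 1) * sonin k 0 <= 3 / 2).
  { unfold sonin. replace (1 - 0 ^ 2) with 1 by ring. rewrite sqrt_1.
    destruct k as [|[|k]].
    - unfold leg; simpl. lra.
    - simpl; unfold leg; simpl. lra.
    - rewrite (dleg_S (S k)).
      pose proof (leg_at_0_bound (S k) ltac:(lia)) as Hb1.
      pose proof (leg_at_0_bound (S (S k)) ltac:(lia)) as Hb2.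
      pose proof (leg_at_0_even_odd (S k)) as Hz.
      rewrite !S_INR in *. set (t := INR k) in *. assert (Ht : 0 <= t) by apply pos_INR.
      set (u := leg (S k) 0) in *. set (v := leg (S (S k)) 0) in *.
      replace (1 * (v ^ 2 + (0 * v - 2 * (1 * (0 * dleg (S k) 0 + (t + 1 + 1) * u))) ^ 2 /
                 ((2 * (t + 1 + 1) + 1) ^ 2 * 1 + 1)))
        with (v ^ 2 + 4 * (t + 2) ^ 2 * u ^ 2 / ((2 * t + 5) ^ 2 + 1)) by (field; nra).
      assert (HD : 0 < (2 * t + 5) ^ 2 + 1) by nra.
      (* One of two consecutive values at 0 vanishes, so in degree [n] only the term of [P_n(0)] or
         that of [P'_n(0) = n P_{n-1}(0)] is left. *)
      destruct (Rmult_integral _ _ Hz) as [E0|E0]; rewrite E0.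
      + replace (4 * (t + 2) ^ 2 * 0 ^ 2 / ((2 * t + 5) ^ 2 + 1)) with 0 by (field; lra). nra.
      + apply Rle_trans with ((2 * (t + 1 + 1) + 1) * (3 * (t + 2) / ((2 * t + 5) ^ 2 + 1))).
        * apply Rmult_le_compat_l; [lra|].
          replace (0 ^ 2 + 4 * (t + 2) ^ 2 * u ^ 2 / ((2 * t + 5) ^ 2 + 1))
            with (4 * (t + 2) * ((t + 1 + 1) * u ^ 2) / ((2 * t + 5) ^ 2 + 1)) by (field; lra).
          apply Rmult_le_compat_r; [left; now apply Rinv_0_lt_compat|]. nra.
        * apply Rmult_le_reg_r with ((2 * t + 5) ^ 2 + 1); [lra|].
          replace ((2 * (t + 1 + 1) + 1) * (3 * (t + 2) / ((2 * t + 5) ^ 2 + 1)) * ((2 * t + 5) ^ 2 + 1))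
            with ((2 * t + 5) * (3 * (t + 2))) by (field; lra). nra. }
  pose proof (sonin_le k x Hx').
  assert (0 <= sqrt (1 - x ^ 2) * leg k x ^ 2) by (apply Rmult_le_pos; [apply sqrt_pos|apply pow2_ge_0]).
  nra.
Qed.

(** * Orthonormality, coefficients and polynomial spans *)

Lemma ex_RInt_cont (f : R -> R) u v : (forall x, continuous f x) -> ex_RInt f u v.
Proof. intros H. apply (ex_RInt_continuous f). intros; apply H. Qed.

Lemma RInt_leg_leg_neq k l : k <> l -> RInt (fun x => leg k x * leg l x) (-1) 1 = 0.
Proof.
  intros Hkl.
  set (c := INR l * (INR l + 1) - INR k * (INR k + 1)).
  assert (Hc : c <> 0).
  { unfold c. intros H. apply Hkl, INR_eq. pose proof (pos_INR k). pose proof (pos_INR l).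
    assert ((INR l - INR k) * (INR l + INR k + 1) = 0) by lra.
    apply Rmult_integral in H2; lra. }
  assert (HI : is_RInt (fun x => c * (leg k x * leg l x)) (-1) 1 0).
  (* [F] is [1 - x^2] times a Wronskian: it vanishes at both endpoints, and its derivative is
     [c P_k P_l]. *)
  { set (F := fun x => (1 - x ^ 2) * dleg k x * leg l x - (1 - x ^ 2) * dleg l x * leg k x).
    replace 0 with (minus (F 1) (F (-1))) by (unfold F, minus, plus, opp; simpl; ring).
    apply (is_RInt_derive (V := R_CompleteNormedModule) F).
    - intros x _. unfold F.
      pose proof (is_derive_leg k x) as A1. pose proof (is_derive_leg l x) as A2.
      pose proof (is_derive_leg_ode k x) as A3. pose proof (is_derive_leg_ode l x) as A4.
      set (g := fun t => (1 - t ^ 2) * dleg k t) in *. set (h := fun t => (1 - t ^ 2) * dleg l t) in *.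
      apply (is_derive_ext (fun x => g x * leg l x - h x * leg k x)); [reflexivity|].
      auto_derive; [repeat split; eexists; eassumption|].
      rewrite (is_derive_unique (fun t : R => leg k t) _ _ A1), (is_derive_unique (fun t : R => leg l t) _ _ A2),
        (is_derive_unique (fun t : R => g t) _ _ A3), (is_derive_unique (fun t : R => h t) _ _ A4).
      unfold g, h, c. ring.
    - intros x _. apply @continuous_mult; [apply continuous_const|].
      apply @continuous_mult; apply continuous_leg. }
  apply (is_RInt_unique (V := R_CompleteNormedModule)) in HI.
  rewrite (RInt_scal (V := R_CompleteNormedModule) (fun x => leg k x * leg l x)) in HI.
  - apply Rmult_integral in HI. tauto.
  - apply ex_RInt_cont; intros. apply @continuous_mult; apply continuous_leg.
Qed.

(** The recurrence evaluates the integral of [x P_k P_{k+1}] in two ways, tested against [P_{k+1}]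
    and against [P_k], which links the norms of consecutive degrees. *)
Lemma RInt_leg_sqr k : RInt (fun x => leg k x * leg k x) (-1) 1 = 2 / (2 * INR k + 1).
Proof.
  assert (Cl : forall i j, ex_RInt (fun x => leg i x * leg j x) (-1) 1).
  { intros; apply ex_RInt_cont; intros. apply @continuous_mult; apply continuous_leg. }
  assert (Cx : forall i j, ex_RInt (fun x => x * (leg i x * leg j x)) (-1) 1).
  { intros; apply ex_RInt_cont; intros. apply @continuous_mult; [apply continuous_id|].
    apply @continuous_mult; apply continuous_leg. }
  assert (Hrec : forall n j,
    (INR n + 2) * RInt (fun x => leg (S (S n)) x * leg j x) (-1) 1 =
    (2 * INR n + 3) * RInt (fun x => x * (leg (S n) x * leg j x)) (-1) 1
    - (INR n + 1) * RInt (fun x => leg n x * leg j x) (-1) 1).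
  { intros n j.
    rewrite <- !(RInt_scal (V := R_CompleteNormedModule)) by auto.
    rewrite <- (RInt_minus (V := R_CompleteNormedModule)).
    - apply RInt_ext. intros x _. unfold scal, minus, plus, opp; simpl; unfold mult; simpl.
      as_R. rewrite <- Rmult_assoc, leg_rec. ring.
    - now apply (ex_RInt_scal (V := R_NormedModule)).
    - now apply (ex_RInt_scal (V := R_NormedModule)). }
  induction k as [|k IH].
  - rewrite (RInt_ext _ (fun _ => 1)) by (intros; unfold leg; simpl; as_R; ring).
    rewrite RInt_const. unfold scal; simpl; unfold mult; simpl. field.
  - assert (H1 : (INR k + 1) * RInt (fun x => leg (S k) x * leg (S k) x) (-1) 1 =
                 (2 * INR k + 1) * RInt (fun x => x * (leg k x * leg (S k) x)) (-1) 1).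
    { destruct k as [|k].
      - rewrite (RInt_ext (fun x => leg 1 x * leg 1 x) (fun x => x * (leg 0 x * leg 1 x)))
          by (intros; unfold leg; simpl; as_R; ring).
        simpl; ring.
      - pose proof (Hrec k (S (S k))) as Hr.
        rewrite (RInt_leg_leg_neq k (S (S k))) in Hr by lia.
        rewrite S_INR. lra. }
    assert (H2 : 0 = (2 * INR k + 3) * RInt (fun x => x * (leg k x * leg (S k) x)) (-1) 1
                     - (INR k + 1) * RInt (fun x => leg k x * leg k x) (-1) 1).
    { pose proof (Hrec k k) as Hr. rewrite (RInt_leg_leg_neq (S (S k)) k) in Hr by lia.
      rewrite (RInt_ext (fun x => x * (leg (S k) x * leg k x)) (fun x => x * (leg k x * leg (S k) x))) in Hr
        by (intros; as_R; ring).
      lra. }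
    rewrite IH in H2. rewrite S_INR. pose proof (pos_INR k).
    set (I := RInt (fun x => x * _) _ _) in *. set (I2 := RInt _ _ _) in *.
    assert (HI : I = (INR k + 1) * (2 / (2 * INR k + 1)) / (2 * INR k + 3)).
    { apply Rmult_eq_reg_l with (2 * INR k + 3); [|lra].
      transitivity ((INR k + 1) * (2 / (2 * INR k + 1))); [lra|field; lra]. }
    apply Rmult_eq_reg_l with (INR k + 1); [|lra]. rewrite H1, HI. field. lra.
Qed.

Lemma legendre_orthonormal k l :
  RInt (fun x => L k x * L l x) (-1) 1 = if Nat.eq_dec k l then 2 else 0.
Proof.
  unfold L.
  rewrite (RInt_ext _ (fun x => sqrt (2 * INR k + 1) * sqrt (2 * INR l + 1) * (leg k x * leg l x)))
    by (intros; unfold leg; as_R; ring).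
  rewrite (RInt_scal (V := R_CompleteNormedModule) (fun x => leg k x * leg l x)).
  2:{ apply ex_RInt_cont; intros. apply @continuous_mult; apply continuous_leg. }
  unfold scal; simpl; unfold mult; simpl.
  destruct Nat.eq_dec as [->|H].
  - rewrite RInt_leg_sqr, sqrt_sqrt; [field|]; pose proof (pos_INR l); lra.
  - rewrite RInt_leg_leg_neq by auto. ring.
Qed.

Definition legsum (n : nat) (c : nat -> R) (x : R) : R := lsum (seq 0 n) (fun k => c k * L k x).

Lemma continuous_lsum {A} (l : list A) (f : A -> R -> R) x :
  (forall a, In a l -> continuous (f a) x) -> continuous (fun x => lsum l (fun a => f a x)) x.
Proof.
  induction l as [|a l IH]; intros H; simpl; [apply continuous_const|].
  apply @continuous_plus; [apply H; now left|apply IH; intros; apply H; now right].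
Qed.

Lemma continuous_legsum n c x : continuous (legsum n c) x.
Proof.
  apply (continuous_lsum (seq 0 n) (fun k x => c k * L k x)). intros.
  apply @continuous_mult; [apply continuous_const|apply continuous_legendre].
Qed.

Lemma RInt_lsum {A} (l : list A) (f : A -> R -> R) u v :
  (forall a, In a l -> ex_RInt (f a) u v) ->
  ex_RInt (fun x => lsum l (fun a => f a x)) u v /\
  RInt (fun x => lsum l (fun a => f a x)) u v = lsum l (fun a => RInt (f a) u v).
Proof.
  induction l as [|a l IH]; intros H; simpl.
  - split; [apply ex_RInt_const|]. rewrite RInt_const. unfold scal; simpl; unfold mult; simpl. ring.
  - destruct IH as [IH1 IH2]; [intros; apply H; now right|]. split.
    + apply @ex_RInt_plus; [apply H; now left|exact IH1].
    + rewrite (RInt_plus (V := R_CompleteNormedModule)); [|apply H; now left|exact IH1].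
      rewrite IH2. reflexivity.
Qed.

Lemma lsum_seq_delta n k c :
  lsum (seq 0 n) (fun i => if Nat.eq_dec i k then c i else 0) = if lt_dec k n then c k else 0.
Proof.
  induction n as [|n IH]; [destruct (lt_dec k 0); [lia|reflexivity]|].
  rewrite lsum_seq_S, IH.
  destruct (Nat.eq_dec n k) as [E|E]; destruct (lt_dec k n) as [E1|E1];
    destruct (lt_dec k (S n)) as [E2|E2]; try lia; try rewrite E; lra.
Qed.

Lemma RInt_legsum_legendre n c k :
  RInt (fun x => legsum n c x * L k x) (-1) 1 = if lt_dec k n then 2 * c k else 0.
Proof.
  unfold legsum.
  rewrite (RInt_ext _ (fun x => lsum (seq 0 n) (fun i => c i * (L i x * L k x)))).
  2:{ intros x _. rewrite Rmult_comm, <- lsum_scal. apply lsum_ext; intros; ring. }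
  assert (HC : forall i, ex_RInt (fun x => L i x * L k x) (-1) 1).
  { intros; apply ex_RInt_cont; intros. apply @continuous_mult; apply continuous_legendre. }
  destruct (RInt_lsum (seq 0 n) (fun i x => c i * (L i x * L k x)) (-1) 1) as [_ ->].
  { intros; now apply (ex_RInt_scal (V := R_NormedModule)). }
  rewrite (lsum_ext _ _ (fun i => if Nat.eq_dec i k then 2 * c i else 0)).
  - apply (lsum_seq_delta n k (fun i => 2 * c i)).
  - intros i _. rewrite (RInt_scal (V := R_CompleteNormedModule) (fun x => L i x * L k x)) by auto.
    unfold scal; simpl; unfold mult; simpl. rewrite legendre_orthonormal.
    destruct Nat.eq_dec; lra.
Qed.

Lemma coef_legsum n c k : coef (legsum n c) k = if lt_dec k n then c k else 0.
Proof. unfold coef. rewrite RInt_legsum_legendre. destruct lt_dec; lra. Qed.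

(** Composition with [clip] extends a function continuous on [-1,1] to one continuous on the whole
    line with the same coefficients. *)
Definition clip (x : R) : R := Rmax (-1) (Rmin 1 x).

Lemma clip_id x : -1 <= x <= 1 -> clip x = x.
Proof. intros. unfold clip. rewrite Rmin_right, Rmax_right; lra. Qed.

Lemma clip_bounds x : -1 <= clip x <= 1.
Proof. unfold clip, Rmax, Rmin. destruct (Rle_dec 1 x); destruct Rle_dec; lra. Qed.

Lemma clip_dist x y : Rabs (clip y - clip x) <= Rabs (y - x).
Proof.
  unfold clip, Rmax, Rmin, Rabs.
  destruct (Rle_dec 1 x), (Rle_dec 1 y);
  repeat match goal with |- context [Rle_dec ?a ?b] => destruct (Rle_dec a b) end;
  repeat match goal with |- context [Rcase_abs ?a] => destruct (Rcase_abs a) end; lra.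
Qed.

Lemma continuous_clip f x : cont_on_I f -> continuous (fun y => f (clip y)) x.
Proof.
  intros H. apply continuity_pt_filterlim. intros eps Heps.
  destruct (H (clip x) (clip_bounds x) eps Heps) as (d & Hd & Hf).
  exists d; split; auto. intros y [_ Hy]. apply Hf; [apply clip_bounds|].
  eapply Rle_lt_trans; [apply clip_dist|exact Hy].
Qed.

Lemma RInt_clip f g :
  RInt (fun x => f x * g x) (-1) 1 = RInt (fun x => f (clip x) * g x) (-1) 1.
Proof.
  apply RInt_ext. intros x. rewrite Rmin_left, Rmax_right by lra. intros Hx.
  rewrite clip_id; [reflexivity|lra].
Qed.

Lemma ex_RInt_cont_on_I f g : cont_on_I f -> (forall x, continuous g x) ->
  ex_RInt (fun x => f x * g x) (-1) 1.
Proof.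
  intros Hf Hg. apply (ex_RInt_ext (fun x => f (clip x) * g x)).
  - intros x. rewrite Rmin_left, Rmax_right by lra. intros Hx. rewrite clip_id; [reflexivity|lra].
  - apply ex_RInt_cont. intros; apply @continuous_mult; [now apply continuous_clip|apply Hg].
Qed.

Lemma cont_on_I_of_continuous f : (forall x, continuous f x) -> cont_on_I f.
Proof.
  intros H x _ eps Heps. specialize (H x). apply continuity_pt_filterlim in H.
  destruct (H eps Heps) as (d & Hd & Hf). exists d; split; auto.
  intros y _ Hy. destruct (Req_dec y x) as [->|Hyx].
  - rewrite Rminus_diag. now rewrite Rabs_R0.
  - apply Hf. repeat split; auto.
Qed.

Lemma coef_minus f g k : cont_on_I f -> (forall x, continuous g x) ->
  coef (fun x => f x - g x) k = coef f k - coef g k.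
Proof.
  intros Hf Hg. unfold coef.
  rewrite (RInt_ext _ (fun x => minus (f x * L k x) (g x * L k x))).
  2:{ intros x _. unfold minus, plus, opp; simpl. ring. }
  rewrite (RInt_minus (V := R_CompleteNormedModule)).
  - unfold minus, plus, opp; simpl. lra.
  - apply ex_RInt_cont_on_I; [auto|apply continuous_legendre].
  - apply ex_RInt_cont. intros; apply @continuous_mult; [auto|apply continuous_legendre].
Qed.

(** [d] counts basis functions, so degrees stay below [d]. In the Legendre basis, orthogonality to a
    remainder is read off coefficient by coefficient. *)
Definition in_span (d : nat) (f : R -> R) : Prop := exists b, forall x, f x = legsum d b x.

Lemma legsum_pad d e b : (d <= e)%nat ->
  forall x, legsum e (fun k => if lt_dec k d then b k else 0) x = legsum d b x.
Proof.
  intros Hde x. unfold legsum. replace e with (d + (e - d))%nat by lia.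
  rewrite seq_app, lsum_app. simpl.
  rewrite (lsum_zero (seq d (e - d))).
  - rewrite Rplus_0_r. apply lsum_ext; intros k Hk. apply in_seq in Hk.
    destruct lt_dec; [reflexivity|lia].
  - intros k Hk. apply in_seq in Hk. destruct lt_dec; [lia|ring].
Qed.

Lemma in_span_weaken d e f : (d <= e)%nat -> in_span d f -> in_span e f.
Proof.
  intros Hde [b Hb]. exists (fun k => if lt_dec k d then b k else 0).
  intros x. rewrite legsum_pad; auto.
Qed.

Lemma in_span_comb d f g s t : in_span d f -> in_span d g -> in_span d (fun x => s * f x + t * g x).
Proof.
  intros [b Hb] [c Hc]. exists (fun k => s * b k + t * c k). intros x. rewrite Hb, Hc.
  unfold legsum. rewrite <- !lsum_scal, <- lsum_plus. apply lsum_ext; intros; ring.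
Qed.

Lemma in_span_ext d f g : (forall x, f x = g x) -> in_span d f -> in_span d g.
Proof. intros H [b Hb]. exists b; intros; rewrite <- H; auto. Qed.

Lemma in_span_leg n : in_span (S n) (leg n).
Proof.
  exists (fun k => if Nat.eq_dec k n then / sqrt (2 * INR n + 1) else 0).
  intros x. unfold legsum.
  assert (0 < sqrt (2 * INR n + 1)) by (apply sqrt_lt_R0; pose proof (pos_INR n); lra).
  rewrite (lsum_ext _ _ (fun k => if Nat.eq_dec k n then leg k x else 0)).
  - rewrite (lsum_seq_delta (S n) n (fun k => leg k x)). destruct lt_dec; [reflexivity|lia].
  - intros k _. destruct Nat.eq_dec as [->|]; [|ring]. unfold L, leg. field. lra.
Qed.

(** The three-term recurrence read backwards: [x P_{d+1}] is a combination of [P_{d+2}] and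
    [P_d]. *)
Lemma in_span_mul_x d f : in_span d f -> in_span (S d) (fun x => x * f x).
Proof.
  intros [b Hb]. apply (in_span_ext _ (fun x => x * legsum d b x)); [intros; now rewrite Hb|].
  clear f Hb. induction d as [|d IH].
  - exists (fun _ => 0). intros x. unfold legsum; simpl. ring.
  - assert (Hx : in_span (S (S d)) (fun x => x * leg d x)).
    { destruct d as [|d].
      - apply (in_span_ext _ (leg 1)); [intros; unfold leg; simpl; ring|apply in_span_leg].
      - pose proof (pos_INR d).
        apply (in_span_ext _ (fun x => ((INR d + 2) / (2 * INR d + 3)) * leg (S (S d)) x
                                     + ((INR d + 1) / (2 * INR d + 3)) * leg d x)).
        + intros x. pose proof (leg_rec d x) as Hr.
          replace ((INR d + 2) / (2 * INR d + 3) * leg (S (S d)) x) with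
            ((INR d + 2) * leg (S (S d)) x / (2 * INR d + 3)) by (field; lra).
          rewrite Hr. field. lra.
        + apply in_span_comb; [apply in_span_leg|].
          apply (in_span_weaken (S d)); [lia|apply in_span_leg]. }
    apply (in_span_ext _ (fun x => 1 * (x * legsum d b x) + b d * sqrt (2 * INR d + 1) * (x * leg d x))).
    + intros x. unfold legsum. rewrite lsum_seq_S. unfold L, leg. ring.
    + apply in_span_comb; [|exact Hx]. apply (in_span_weaken (S d)); [lia|exact IH].
Qed.

Definition is_poly (N : nat) (f : R -> R) : Prop := exists a, forall x, poly_eval N a x = f x.

Lemma poly_eval_comb N a b s t x :
  poly_eval N (fun k => s * a k + t * b k) x = s * poly_eval N a x + t * poly_eval N b x.
Proof. unfold poly_eval. induction N as [|N IH]; simpl; [ring|rewrite IH; simpl; ring]. Qed.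

Lemma is_poly_comb N f g s t : is_poly N f -> is_poly N g -> is_poly N (fun x => s * f x + t * g x).
Proof.
  intros [a Ha] [b Hb]. exists (fun k => s * a k + t * b k).
  intros x. now rewrite poly_eval_comb, Ha, Hb.
Qed.

Lemma is_poly_S N f : is_poly N f -> is_poly (S N) f.
Proof.
  intros [a Ha]. exists (fun k => if le_dec k N then a k else 0). intros x. rewrite <- Ha.
  unfold poly_eval. simpl sum_f_R0. destruct le_dec; [lia|].
  rewrite Rmult_0_l, Rplus_0_r. apply sum_eq. intros i Hi. destruct le_dec; [reflexivity|lia].
Qed.

Lemma is_poly_mul_x N f : is_poly N f -> is_poly (S N) (fun x => x * f x).
Proof.
  intros [a Ha]. exists (fun k => match k with O => 0 | S k => a k end). intros x.
  rewrite <- Ha. unfold poly_eval. clear Ha.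
  induction N as [|N IH]; [simpl; ring|].
  rewrite tech5, IH. simpl. ring.
Qed.

Lemma is_poly_leg n : is_poly n (leg n).
Proof.
  enough (H : is_poly n (leg n) /\ is_poly (S n) (leg (S n))) by apply H.
  induction n as [|n [IH1 IH2]].
  - split.
    + exists (fun _ => 1). intros; unfold poly_eval, leg; simpl; ring.
    (* Only the indices 0 and 1 are read, where [INR k] gives the coefficients of [x]. *)
    + exists (fun k => INR k). intros; unfold poly_eval, leg; simpl; ring.
  - split; auto. pose proof (pos_INR n).
    destruct (is_poly_comb (S (S n)) (fun x => x * leg (S n) x) (leg n)
       ((2 * INR n + 3) / (INR n + 2)) (- ((INR n + 1) / (INR n + 2)))) as [a Ha].
    + now apply is_poly_mul_x.
    + now apply is_poly_S, is_poly_S.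
    + exists a. intros x. rewrite Ha. pose proof (leg_rec n x).
      apply Rmult_eq_reg_l with (INR n + 2); [|lra]. rewrite H0. field. lra.
Qed.

Lemma is_poly_legsum N D c : (D <= N)%nat -> is_poly N (legsum (S D) c).
Proof.
  intros HDN. unfold is_poly.
  assert (H : is_poly D (legsum (S D) c)).
  { induction D as [|D IH].
    - exists (fun _ => c 0%nat). intros x. unfold poly_eval, legsum, L; simpl. rewrite Rmult_0_r, Rplus_0_l, sqrt_1. ring.
    - destruct (is_poly_comb (S D) (legsum (S D) c) (leg (S D)) 1 (c (S D) * sqrt (2 * INR (S D) + 1)))
        as [a Ha]; [apply is_poly_S, IH; lia|apply is_poly_leg|].
      exists a. intros x. rewrite Ha. unfold legsum. rewrite (lsum_seq_S (S D)). unfold L, leg. ring. }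
  induction HDN as [|N _ IH]; [exact H|]. now apply is_poly_S.
Qed.

(** * A discrete frame from the Chebyshev angles *)

Lemma bounded_on_segment (f : R -> R) u v : u <= v -> (forall x, continuous f x) ->
  exists B, 0 <= B /\ forall x, u <= x <= v -> Rabs (f x) <= B.
Proof.
  intros Huv H.
  assert (Hc : forall x, u <= x <= v -> continuity_pt (fun x => Rabs (f x)) x).
  { intros x _. apply continuity_pt_filterlim.
    apply (continuous_comp f Rabs); [apply H|apply @continuous_Rabs]. }
  destruct (continuity_ab_maj _ u v Huv Hc) as (z & Hz & _).
  exists (Rabs (f z)). split; [apply Rabs_pos|apply Hz].
Qed.

(** Two applications of the mean value theorem bound the error of the left endpoint rule by
    [B * h ^ 2] on each cell. *)
Lemma riemann_sum_error (G g g' : R -> R) B h M : 0 <= h ->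
  (forall t, is_derive G t (g t)) -> (forall t, is_derive g t (g' t)) ->
  (forall t, Rabs (g' t) <= B) ->
  Rabs (lsum (seq 0 M) (fun j => h * g (INR j * h)) - (G (INR M * h) - G 0)) <= INR M * (B * h ^ 2).
Proof.
  intros Hh HG Hg HB. induction M as [|M IH].
  - simpl. rewrite Rmult_0_l, Rminus_diag, Rminus_diag, Rabs_R0. lra.
  - rewrite lsum_seq_S.
    assert (Hstep : Rabs (h * g (INR M * h) - (G (INR (S M) * h) - G (INR M * h))) <= B * h ^ 2).
    { destruct (MVT_gen G (INR M * h) (INR (S M) * h) g) as (t & Ht & Het).
      - intros; apply HG.
      - intros; apply continuity_pt_filterlim, (ex_derive_continuous G). eexists; apply HG.
      - destruct (MVT_gen g (INR M * h) t g') as (r & _ & Her).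
        + intros; apply Hg.
        + intros; apply continuity_pt_filterlim, (ex_derive_continuous g). eexists; apply Hg.
        + rewrite S_INR in *.
          assert (Htd : Rabs (t - INR M * h) <= h).
          { unfold Rmin, Rmax in Ht. destruct Rle_dec; apply Rabs_le; lra. }
          rewrite Het.
          replace (h * g (INR M * h) - g t * ((INR M + 1) * h - INR M * h))
            with (- (h * (g t - g (INR M * h)))) by ring.
          rewrite Rabs_Ropp, Her, !Rabs_mult, (Rabs_pos_eq h) by lra.
          specialize (HB r). pose proof (Rabs_pos (g' r)). pose proof (Rabs_pos (t - INR M * h)).
          assert (Rabs (g' r) * Rabs (t - INR M * h) <= B * h) by (apply Rmult_le_compat; lra).
          nra. }
    rewrite (S_INR M) at 2.
    replace (_ - _) with ((lsum (seq 0 M) (fun j => h * g (INR j * h)) - (G (INR M * h) - G 0))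
      + (h * g (INR M * h) - (G (INR (S M) * h) - G (INR M * h)))) by ring.
    eapply Rle_trans; [apply Rabs_triang|]. lra.
Qed.

Definition wleg (x : R) (k : nat) : R := w x * L k x.

Definition angles (M : nat) : list R := map (fun j => cos (INR j * (PI / INR M))) (seq 0 M).

Lemma w_cos_sqr t : 0 <= t <= PI -> w (cos t) ^ 2 = PI / 2 * sin t.
Proof.
  intros Ht. unfold w. rewrite Rpow_mult_distr.
  rewrite !pow2_sqrt; [|apply sqrt_pos|pose proof PI_RGT_0; lra].
  f_equal. replace (1 - cos t ^ 2) with (sin t ^ 2).
  - replace (sin t ^ 2) with (sin t * sin t) by ring. apply sqrt_square. apply sin_ge_0; lra.
  - pose proof (sin2_cos2 t). unfold Rsqr in H. lra.
Qed.

(** Uniform angles discretise the Chebyshev measure, and [w (cos t) ^ 2 = PI / 2 * sin t] is the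
    Jacobian turning the average over angles into half the integral in [x]. The limit is thus the
    identity matrix, with a Riemann error of order [1 / M]. *)
Lemma angles_gram k l : exists B, 0 <= B /\ forall M, (1 <= M)%nat ->
  Rabs (avg (angles M) (fun x => wleg x k * wleg x l) - if Nat.eq_dec k l then 1 else 0) <= B / INR M.
Proof.
  set (p := fun x => L k x * L l x).
  set (p' := fun x => sqrt (2 * INR k + 1) * sqrt (2 * INR l + 1) * (dleg k x * leg l x + leg k x * dleg l x)).
  assert (Hp : forall x, is_derive p x (p' x)).
  { intros x. pose proof (is_derive_leg k x) as H1. pose proof (is_derive_leg l x) as H2.
    unfold p, L. fold (leg k x).
    apply (is_derive_ext (fun x => sqrt (2 * INR k + 1) * sqrt (2 * INR l + 1) * (leg k x * leg l x))).
    { intros; unfold leg; as_R; ring. }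
    auto_derive; [repeat split; eexists; eassumption|].
    rewrite (is_derive_unique (fun t : R => leg k t) _ _ H1), (is_derive_unique (fun t : R => leg l t) _ _ H2).
    unfold p'. ring. }
  assert (Cp : forall x, continuous p x) by (intros; apply (ex_derive_continuous p); eexists; apply Hp).
  assert (Cp' : forall x, continuous p' x).
  { intros x. apply @continuous_mult; [apply continuous_const|].
    apply @continuous_plus; apply @continuous_mult; auto using continuous_leg, continuous_dleg. }
  destruct (bounded_on_segment p (-1) 1 ltac:(lra) Cp) as (B1 & HB1 & Hb1).
  destruct (bounded_on_segment p' (-1) 1 ltac:(lra) Cp') as (B2 & HB2 & Hb2).
  set (Phi := fun x => RInt p (-1) x).
  assert (HPhi : forall x, is_derive Phi x (p x)).
  { intros x. apply (is_derive_RInt (V := R_NormedModule) p Phi (-1)).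
    - apply filter_forall. intros y. apply (RInt_correct (V := R_CompleteNormedModule)).
      now apply ex_RInt_cont.
    - apply Cp. }
  set (G := fun t => - Phi (cos t)). set (g := fun t => sin t * p (cos t)).
  set (g' := fun t => cos t * p (cos t) - sin t ^ 2 * p' (cos t)).
  exists ((B1 + B2) * PI ^ 2 / 2). split.
  { pose proof (pow2_ge_0 PI). assert (0 <= (B1 + B2) * PI ^ 2) by (apply Rmult_le_pos; lra). lra. }
  intros M HM.
  assert (HM0 : 0 < INR M) by (apply lt_0_INR; lia).
  pose proof PI_RGT_0 as Hpi.
  pose proof (riemann_sum_error G g g' (B1 + B2) (PI / INR M) M) as Hr.
  assert (HMh : INR M * (PI / INR M) = PI) by (field; lra).
  rewrite HMh in Hr.
  assert (HGd : G PI - G 0 = if Nat.eq_dec k l then 2 else 0).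
  { unfold G. rewrite cos_PI, cos_0. unfold Phi. rewrite RInt_point.
    unfold p. rewrite legendre_orthonormal. unfold zero; simpl. lra. }
  rewrite HGd in Hr.
  assert (Havg : avg (angles M) (fun x => wleg x k * wleg x l) =
    / 2 * lsum (seq 0 M) (fun j => PI / INR M * g (INR j * (PI / INR M)))).
  { unfold avg, angles. rewrite length_map, length_seq, lsum_map.
    unfold Rdiv at 1. rewrite Rmult_comm, <- !lsum_scal. apply lsum_ext. intros j Hj.
    apply in_seq in Hj. set (t := INR j * (PI / INR M)).
    assert (Ht : 0 <= t <= PI).
    { unfold t. split.
      - apply Rmult_le_pos; [apply pos_INR|]. apply Rmult_le_pos; [lra|left; now apply Rinv_0_lt_compat].
      - rewrite <- HMh at 2. apply Rmult_le_compat_r; [|apply le_INR; lia].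
        apply Rmult_le_pos; [lra|left; now apply Rinv_0_lt_compat]. }
    unfold wleg. replace (w (cos t) * L k (cos t) * (w (cos t) * L l (cos t)))
      with (w (cos t) ^ 2 * p (cos t)) by (unfold p; ring).
    rewrite w_cos_sqr by auto. unfold g. field. lra. }
  rewrite Havg.
  replace (/ 2 * lsum (seq 0 M) (fun j => PI / INR M * g (INR j * (PI / INR M))) - (if Nat.eq_dec k l then 1 else 0))
    with (/ 2 * (lsum (seq 0 M) (fun j => PI / INR M * g (INR j * (PI / INR M))) - (if Nat.eq_dec k l then 2 else 0)))
    by (destruct Nat.eq_dec; lra).
  rewrite Rabs_mult, (Rabs_pos_eq (/ 2)) by lra.
  replace ((B1 + B2) * PI ^ 2 / 2 / INR M) with (/ 2 * (INR M * ((B1 + B2) * (PI / INR M) ^ 2)))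
    by (field; lra).
  apply Rmult_le_compat_l; [lra|]. apply Hr.
  - apply Rmult_le_pos; [lra|left; now apply Rinv_0_lt_compat].
  - intros t. unfold G, g. pose proof (HPhi (cos t)) as H1.
    auto_derive; [repeat split; eexists; eassumption|].
    rewrite (is_derive_unique (fun t : R => Phi t) _ _ H1). ring.
  - intros t. unfold g, g'. pose proof (Hp (cos t)) as H1.
    auto_derive; [repeat split; eexists; eassumption|].
    rewrite (is_derive_unique (fun t : R => p t) _ _ H1). ring.
  - intros t. unfold g'. pose proof (COS_bound t) as Hc. pose proof (sin2_cos2 t) as Hsc. unfold Rsqr in Hsc.
    specialize (Hb1 (cos t) Hc). specialize (Hb2 (cos t) Hc).
    apply Rabs_le_between in Hb1. apply Rabs_le_between in Hb2.
    assert (Rabs (cos t * p (cos t)) <= B1).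
    { rewrite Rabs_mult. assert (Rabs (cos t) <= 1) by (apply Rabs_le; lra).
      assert (Rabs (p (cos t)) <= B1) by (apply Rabs_le; lra).
      pose proof (Rabs_pos (cos t)). pose proof (Rabs_pos (p (cos t))). nra. }
    assert (Rabs (sin t ^ 2 * p' (cos t)) <= B2).
    { rewrite Rabs_mult. assert (Rabs (sin t ^ 2) <= 1) by (apply Rabs_le; nra).
      assert (Rabs (p' (cos t)) <= B2) by (apply Rabs_le; lra).
      pose proof (Rabs_pos (sin t ^ 2)). pose proof (Rabs_pos (p' (cos t))). nra. }
    unfold Rminus. eapply Rle_trans; [apply Rabs_triang|]. rewrite Rabs_Ropp. lra.
Qed.

(** On enough angles the Gram matrix is within [1 / (2n)] of the identity in every entry, so the
    quadratic form changes by at most [|c|_1^2 / (2n) <= |c|_2^2 / 2]. The size of this reference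
    set does not enter the number of samples. *)
Lemma exists_frame n : exists Om : list R, Om <> nil /\
  (forall x, In x Om -> -1 <= x <= 1) /\
  forall c, lsum (seq 0 n) (fun k => c k ^ 2) / 2 <= avg Om (fun x => form wleg n c x ^ 2).
Proof.
  set (B := fun k l => proj1_sig (constructive_indefinite_description _ (angles_gram k l))).
  assert (HB : forall k l, 0 <= B k l /\ forall M, (1 <= M)%nat ->
    Rabs (avg (angles M) (fun x => wleg x k * wleg x l) - if Nat.eq_dec k l then 1 else 0) <= B k l / INR M).
  { intros k l. unfold B. destruct constructive_indefinite_description as [b Hb]. exact Hb. }
  clearbody B.
  set (T := lsum (seq 0 n) (fun k => lsum (seq 0 n) (fun l => B k l))).
  assert (HT : forall k l, In k (seq 0 n) -> In l (seq 0 n) -> B k l <= T).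
  { intros k l Hk Hl. eapply Rle_trans; [|apply (lsum_term_le (seq 0 n) _ k); auto].
    - apply (lsum_term_le (seq 0 n) (fun l => B k l)); auto. intros; apply HB.
    - intros; apply lsum_nonneg; intros; apply HB. }
  assert (HT0 : 0 <= T) by (apply lsum_nonneg; intros; apply lsum_nonneg; intros; apply HB).
  destruct (INR_unbounded (2 * INR n * T)) as [M0 HM0].
  set (M := S M0).
  assert (HM : 2 * INR n * T < INR M) by (unfold M; rewrite S_INR; lra).
  assert (HMp : 0 < INR M) by (apply lt_0_INR; unfold M; lia).
  exists (angles M). repeat split.
  - unfold angles, M. simpl. discriminate.
  - apply in_map_iff in H as (j & <- & _). apply COS_bound.
  - apply in_map_iff in H as (j & <- & _). apply COS_bound.
  - intros c.
    set (gr := fun k l => avg (angles M) (fun x => wleg x k * wleg x l)).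
    assert (Hq : avg (angles M) (fun x => form wleg n c x ^ 2) =
      lsum (seq 0 n) (fun k => lsum (seq 0 n) (fun l => c k * c l * gr k l))).
    { transitivity (avg (angles M) (fun x => lsum (seq 0 n) (fun k => 1 * lsum (seq 0 n) (fun l => c k * c l * (wleg x k * wleg x l))))).
      - unfold avg. f_equal. apply lsum_ext; intros x _. unfold form. simpl. rewrite Rmult_1_r.
        rewrite <- lsum_scal. apply lsum_ext; intros k _.
        rewrite Rmult_1_l, Rmult_comm, <- lsum_scal. apply lsum_ext; intros; ring.
      - rewrite (avg_lsum (angles M) (seq 0 n) (fun _ => 1)
          (fun k x => lsum (seq 0 n) (fun l => c k * c l * (wleg x k * wleg x l)))).
        apply lsum_ext; intros k _. rewrite Rmult_1_l.
        rewrite (avg_lsum (angles M) (seq 0 n) (fun l => c k * c l) (fun l x => wleg x k * wleg x l)).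
        reflexivity. }
    rewrite Hq.
    assert (Hdiag : lsum (seq 0 n) (fun k => c k ^ 2) =
      lsum (seq 0 n) (fun k => lsum (seq 0 n) (fun l => c k * c l * (if Nat.eq_dec k l then 1 else 0)))).
    { apply lsum_ext; intros k Hk. apply in_seq in Hk.
      rewrite (lsum_ext _ _ (fun l => if Nat.eq_dec l k then c l * c l else 0)).
      - rewrite (lsum_seq_delta n k (fun l => c l * c l)). destruct lt_dec; [ring|lia].
      - intros l _. destruct (Nat.eq_dec k l) as [->|]; destruct Nat.eq_dec; subst; try lia; ring. }
    set (e := / (2 * INR n)).
    destruct (Nat.eq_dec n 0) as [Hn|Hn]; [rewrite Hn; simpl; lra|].
    assert (Hn0 : 0 < INR n) by (apply lt_0_INR; lia).
    assert (Hgr : forall k l, In k (seq 0 n) -> In l (seq 0 n) ->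
      Rabs (gr k l - if Nat.eq_dec k l then 1 else 0) <= e).
    { intros k l Hk Hl. eapply Rle_trans; [apply HB; unfold M; lia|].
      apply Rle_trans with (T / INR M).
      - apply Rmult_le_compat_r; [left; now apply Rinv_0_lt_compat|auto].
      - unfold e. apply Rmult_le_reg_r with (INR M * (2 * INR n)); [apply Rmult_lt_0_compat; lra|].
        replace (T / INR M * (INR M * (2 * INR n))) with (2 * INR n * T) by (field; lra).
        replace (/ (2 * INR n) * (INR M * (2 * INR n))) with (INR M) by (field; lra). lra. }
    assert (Hdiff : Rabs (lsum (seq 0 n) (fun k => lsum (seq 0 n) (fun l => c k * c l * gr k l)) -
      lsum (seq 0 n) (fun k => c k ^ 2)) <= e * Rsqr (l1 n c)).
    { rewrite Hdiag, <- lsum_minus.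
      eapply Rle_trans; [apply lsum_abs|].
      replace (e * Rsqr (l1 n c)) with (lsum (seq 0 n) (fun k => e * l1 n c * Rabs (c k))).
      2:{ rewrite lsum_scal. fold (l1 n c). unfold Rsqr. ring. }
      apply lsum_le; intros k Hk. rewrite <- lsum_minus.
      eapply Rle_trans; [apply lsum_abs|].
      replace (e * l1 n c * Rabs (c k)) with (lsum (seq 0 n) (fun l => Rabs (c k) * e * Rabs (c l))).
      2:{ rewrite lsum_scal. fold (l1 n c). ring. }
      apply lsum_le; intros l Hl.
      rewrite <- Rmult_minus_distr_l, !Rabs_mult.
      specialize (Hgr k l Hk Hl). pose proof (Rabs_pos (c k)). pose proof (Rabs_pos (c l)).
      replace (Rabs (c k) * e * Rabs (c l)) with (Rabs (c k) * Rabs (c l) * e) by ring.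
      apply Rmult_le_compat_l; [now apply Rmult_le_pos|auto]. }
    assert (Hcs : Rsqr (l1 n c) <= INR n * lsum (seq 0 n) (fun k => c k ^ 2)).
    { pose proof (lsum_cauchy_schwarz (seq 0 n) (fun _ => 1) (fun k => Rabs (c k))) as Hc.
      rewrite (lsum_ext _ (fun a => 1 * Rabs (c a)) (fun k => Rabs (c k))) in Hc by (intros; ring).
      rewrite (lsum_ext _ (fun a => Rabs (c a) ^ 2) (fun k => c k ^ 2)) in Hc by (intros; apply pow2_abs).
      rewrite pow1, lsum_const, length_seq, Rmult_1_r in Hc. exact Hc. }
    assert (He : e * Rsqr (l1 n c) <= lsum (seq 0 n) (fun k => c k ^ 2) / 2).
    { apply Rle_trans with (e * (INR n * lsum (seq 0 n) (fun k => c k ^ 2))).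
      - apply Rmult_le_compat_l; [left; unfold e; apply Rinv_0_lt_compat; lra|auto].
      - unfold e. right; field. lra. }
    apply Rabs_le_between in Hdiff. lra.
Qed.

(** * Pointwise convergence of the weighted Legendre series *)

Lemma sum_n_lsum (a : nat -> R) n : sum_n a n = lsum (seq 0 (S n)) a.
Proof.
  induction n as [|n IH]; [rewrite sum_O; simpl; ring|].
  rewrite sum_Sn, IH, (lsum_seq_S (S n)). reflexivity.
Qed.

Lemma lsum_diff_le (a b : nat -> R) K n N : (n <= N)%nat ->
  (forall k, Rabs (a k) <= K * b k) ->
  Rabs (lsum (seq 0 N) a - lsum (seq 0 n) a) <= K * (lsum (seq 0 N) b - lsum (seq 0 n) b).
Proof.
  intros HnN Hab. replace N with (n + (N - n))%nat by lia.
  rewrite seq_app, !lsum_app. simpl.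
  replace (_ - _) with (lsum (seq n (N - n)) a) by ring.
  replace (_ - _) with (lsum (seq n (N - n)) b) by ring.
  rewrite <- lsum_scal. eapply Rle_trans; [apply lsum_abs|]. now apply lsum_le.
Qed.

Lemma is_lim_seq_lsum a : ex_series a -> is_lim_seq (fun n => lsum (seq 0 (S n)) a) (Series a).
Proof.
  intros H. apply (is_lim_seq_ext (sum_n a)); [apply sum_n_lsum|]. now apply Series_correct.
Qed.

Lemma ex_series_dominated (a b : nat -> R) K :
  ex_series b -> (forall k, Rabs (a k) <= K * b k) -> ex_series a.
Proof.
  intros Hb Hab. apply ex_series_Rabs.
  apply (ex_series_le (K := R_AbsRing) (V := R_CompleteNormedModule) _ (fun k => K * b k)).
  - intros k. unfold norm; simpl; unfold abs; simpl. rewrite Rabs_Rabsolu. apply Hab.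
  - now apply (ex_series_scal_l K b).
Qed.

Lemma series_tail_le (a b : nat -> R) K n :
  ex_series b -> (forall k, Rabs (a k) <= K * b k) ->
  Rabs (Series a - lsum (seq 0 n) a) <= K * (Series b - lsum (seq 0 n) b).
Proof.
  intros Hb Hab. pose proof (ex_series_dominated a b K Hb Hab) as Ha.
  apply (is_lim_seq_le_loc
    (fun N => Rabs (lsum (seq 0 (S N)) a - lsum (seq 0 n) a))
    (fun N => K * (lsum (seq 0 (S N)) b - lsum (seq 0 n) b))
    (Rabs (Series a - lsum (seq 0 n) a)) (K * (Series b - lsum (seq 0 n) b))).
  - exists n. intros N HN. apply lsum_diff_le; auto.
  - apply (is_lim_seq_abs _ (Series a - lsum (seq 0 n) a)).
    apply is_lim_seq_minus'; [now apply is_lim_seq_lsum|apply is_lim_seq_const].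
  - apply (is_lim_seq_scal_l _ K (Series b - lsum (seq 0 n) b)).
    apply is_lim_seq_minus'; [now apply is_lim_seq_lsum|apply is_lim_seq_const].
Qed.

Lemma lsum_le_Series (a : nat -> R) n : ex_series a -> (forall k, 0 <= a k) ->
  lsum (seq 0 n) a <= Series a.
Proof.
  intros Ha H0.
  pose proof (series_tail_le a a 1 n Ha) as H.
  assert (Hk : forall k, Rabs (a k) <= 1 * a k) by (intros; rewrite Rabs_pos_eq; [lra|auto]).
  specialize (H Hk). pose proof (Rabs_pos (Series a - lsum (seq 0 n) a)). lra.
Qed.

Lemma Series_nonneg (a : nat -> R) : ex_series a -> (forall k, 0 <= a k) -> 0 <= Series a.
Proof. intros Ha H0. apply (lsum_le_Series a 0 Ha H0). Qed.

(** At least 1 within distance [d] of [x0], and between 0 and 1 elsewhere on [-1,1]; the divisor 4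
    prevents negative values, as distances there are at most 2. *)
Definition peak (x0 d x : R) : R := 1 + (d ^ 2 - (x - x0) ^ 2) / 4.

Lemma continuous_peak_pow x0 d j x : continuous (fun y => peak x0 d y ^ j) x.
Proof. apply (ex_derive_continuous (fun y => peak x0 d y ^ j)). unfold peak. now auto_derive. Qed.

(** Within [d / 2] of [x0] the peak is at least [1 + 3 d^2 / 16], and its powers outgrow the bounded
    loss away from [x0]. The exponent is fixed before [e], because [e] will be a remainder whose
    index depends on [j]. *)
Lemma RInt_mul_peak_pos x0 d eta B : 0 < d -> -1 <= x0 - d -> x0 + d <= 1 -> 0 < eta -> 0 <= B ->
  exists j, forall e : R -> R, (forall x, continuous e x) ->
    (forall x, -1 <= x <= 1 -> Rabs (x - x0) <= d -> eta <= e x) ->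
    (forall x, -1 <= x <= 1 -> Rabs (e x) <= B) ->
    0 < RInt (fun x => e x * peak x0 d x ^ j) (-1) 1.
Proof.
  intros Hd Hl Hr Heta HB.
  assert (Hgrow : 0 < 3 * d ^ 2 / 16) by (pose proof (pow_lt d 2 Hd); lra).
  destruct (INR_unbounded (2 * B / (eta * d * (3 * d ^ 2 / 16)))) as [j Hj].
  exists j. intros e He Hpos Hbd.
  set (r := 1 + 3 * d ^ 2 / 16) in *.
  assert (Hrj : 2 * B < eta * d * r ^ j).
  { pose proof (poly j (3 * d ^ 2 / 16) Hgrow) as Hp. fold r in Hp.
    assert (Hed : 0 < eta * d) by now apply Rmult_lt_0_compat.
    assert (H2 : 2 * B < eta * d * (INR j * (3 * d ^ 2 / 16))).
    { apply Rmult_lt_reg_r with (/ (eta * d * (3 * d ^ 2 / 16))).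
      - apply Rinv_0_lt_compat, Rmult_lt_0_compat; lra.
      - replace (eta * d * (INR j * (3 * d ^ 2 / 16)) * / (eta * d * (3 * d ^ 2 / 16))) with (INR j)
          by (field; lra). exact Hj. }
    nra. }
  set (F := fun x => e x * peak x0 d x ^ j).
  assert (CF : forall u v, ex_RInt F u v).
  { intros; apply ex_RInt_cont; intros. apply @continuous_mult; [auto|apply continuous_peak_pow]. }
  assert (Hout : forall x, -1 <= x <= 1 -> - B <= F x).
  { intros x Hx. unfold F. destruct (Rle_dec (Rabs (x - x0)) d) as [Hin|Hout].
    - specialize (Hpos x Hx Hin). apply Rabs_le_between in Hin.
      assert (1 <= peak x0 d x) by (unfold peak; nra).
      assert (0 <= peak x0 d x ^ j) by (apply pow_le; lra). nra.
    - assert (Hp : 0 <= peak x0 d x <= 1).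
      { unfold peak. assert (d ^ 2 <= (x - x0) ^ 2).
        { rewrite <- (pow2_abs (x - x0)). nra. }
        assert ((x - x0) ^ 2 <= 4) by nra. pose proof (pow2_ge_0 d). lra. }
      assert (Hpj : 0 <= peak x0 d x ^ j <= 1).
      { split; [apply pow_le; lra|]. rewrite <- (pow1 j). apply pow_incr; lra. }
      specialize (Hbd x Hx). apply Rabs_le_between in Hbd. nra. }
  assert (Hin : forall x, x0 - d / 2 < x < x0 + d / 2 -> eta * r ^ j <= F x).
  { intros x Hx. unfold F.
    assert (eta <= e x) by (apply Hpos; [lra|apply Rabs_le; lra]).
    assert (r ^ j <= peak x0 d x ^ j).
    { apply pow_incr. unfold r, peak. split; [lra|]. nra. }
    assert (0 <= r ^ j) by (apply pow_le; unfold r; lra). nra. }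
  assert (Hint : forall u v c, u <= v -> (forall x, u < x < v -> c <= F x) -> c * (v - u) <= RInt F u v).
  { intros u v c Huv Hc. replace (c * (v - u)) with (RInt (fun _ => c) u v).
    - apply RInt_le; auto. apply ex_RInt_const.
    - rewrite RInt_const. unfold scal; simpl; unfold mult; simpl. ring. }
  rewrite <- (RInt_Chasles (V := R_CompleteNormedModule) F (-1) (x0 - d / 2) 1) by auto.
  rewrite <- (RInt_Chasles (V := R_CompleteNormedModule) F (x0 - d / 2) (x0 + d / 2) 1) by auto.
  pose proof (Hint (-1) (x0 - d / 2) (- B) ltac:(lra) ltac:(intros; apply Hout; lra)) as I1.
  pose proof (Hint (x0 - d / 2) (x0 + d / 2) (eta * r ^ j) ltac:(lra) Hin) as I2.
  pose proof (Hint (x0 + d / 2) 1 (- B) ltac:(lra) ltac:(intros; apply Hout; lra)) as I3.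
  unfold plus; simpl. nra.
Qed.

Lemma in_span_peak x0 d j : in_span (2 * j + 3) (fun x => (1 - x ^ 2) * peak x0 d x ^ j).
Proof.
  assert (Hquad : forall n f a b c, in_span n f -> in_span (n + 2) (fun x => (a + b * x + c * x ^ 2) * f x)).
  { intros n f a b c Hf. pose proof (in_span_mul_x n f Hf) as H1. pose proof (in_span_mul_x _ _ H1) as H2.
    replace (n + 2)%nat with (S (S n)) by lia.
    apply (in_span_ext _ (fun x => 1 * (a * f x + b * (x * f x)) + c * (x * (x * f x)))).
    - intros; ring.
    - apply in_span_comb; auto. apply in_span_comb.
      + apply (in_span_weaken n); auto.
      + apply (in_span_weaken (S n)); auto. }
  induction j as [|j IH].
  - apply (in_span_ext _ (fun x => (1 + 0 * x + -1 * x ^ 2) * leg 0 x)).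
    + intros; unfold leg; simpl; ring.
    + apply (Hquad 1%nat). apply in_span_leg.
  - apply (in_span_ext _ (fun x => ((1 + (d ^ 2 - x0 ^ 2) / 4) + (x0 / 2) * x + (- / 4) * x ^ 2)
                                    * ((1 - x ^ 2) * peak x0 d x ^ j))).
    + intros x. change (peak x0 d x ^ S j) with (peak x0 d x * peak x0 d x ^ j).
      set (t := peak x0 d x ^ j). unfold peak. field.
    + replace (2 * S j + 3)%nat with (2 * j + 3 + 2)%nat by lia. apply Hquad, IH.
Qed.

Lemma RInt_remainder_span (F : R -> R) d m g : (forall x, continuous F x) -> in_span d g -> (d <= m)%nat ->
  RInt (fun x => (F x - legsum m (coef F) x) * g x) (-1) 1 = 0.
Proof.
  intros HF [b Hb] Hdm. set (e := fun x => F x - legsum m (coef F) x).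
  assert (He : forall x, continuous e x).
  { intros. apply @continuous_minus; [auto|apply continuous_legsum]. }
  rewrite (RInt_ext _ (fun x => lsum (seq 0 d) (fun k => b k * (e x * L k x)))).
  2:{ intros x _. rewrite Hb. as_R. change (F x - legsum m (coef F) x) with (e x).
      unfold legsum at 1. rewrite <- lsum_scal. apply lsum_ext; intros; ring. }
  assert (HC : forall k, ex_RInt (fun x => e x * L k x) (-1) 1).
  { intros; apply ex_RInt_cont; intros. apply @continuous_mult; auto using continuous_legendre. }
  destruct (RInt_lsum (seq 0 d) (fun k x => b k * (e x * L k x)) (-1) 1) as [_ ->].
  { intros; now apply (ex_RInt_scal (V := R_NormedModule)). }
  apply lsum_zero. intros k Hk. apply in_seq in Hk.
  rewrite (RInt_scal (V := R_CompleteNormedModule) (fun x => e x * L k x)) by auto.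
  unfold scal; simpl; unfold mult; simpl.
  assert (Hc : coef e k = 0).
  { unfold e. rewrite coef_minus, coef_legsum.
    - destruct lt_dec; [ring|lia].
    - now apply cont_on_I_of_continuous.
    - apply continuous_legsum. }
  unfold coef in Hc. apply Rmult_integral in Hc. destruct Hc as [Hc|Hc]; [lra|].
  rewrite Hc. ring.
Qed.

Lemma w_nonneg x : 0 <= w x.
Proof. unfold w. apply Rmult_le_pos; apply sqrt_pos. Qed.

(** As a damping factor [1 - x^2] keeps test functions polynomial, while the bounds on [w L_k] still
    control the damped remainders up to the endpoints. *)
Lemma one_minus_sqr_le_w x : -1 <= x <= 1 -> 1 - x ^ 2 <= w x.
Proof.
  intros Hx. assert (H : 0 <= 1 - x ^ 2 <= 1) by nra. unfold w.
  assert (H1 : 1 <= sqrt (PI / 2)).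
  { rewrite <- sqrt_1 at 1. apply sqrt_le_1_alt. pose proof PI2_1. lra. }
  assert (Hs : forall t, 0 <= t <= 1 -> t <= sqrt t <= 1).
  { intros t Ht. split; [|rewrite <- sqrt_1; apply sqrt_le_1_alt; lra].
    rewrite <- (sqrt_square t) at 1 by lra. apply sqrt_le_1_alt. nra. }
  pose proof (Hs _ H) as H2. pose proof (sqrt_pos (1 - x ^ 2)).
  pose proof (Hs (sqrt (1 - x ^ 2)) ltac:(lra)). nra.
Qed.

Lemma wleg_bound x k : -1 <= x <= 1 -> Rabs (wleg x k) <= sqrt 3.
Proof. apply weighted_legendre_bound. Qed.

Lemma coef_wleg_bound c x k : -1 <= x <= 1 -> Rabs (c k * wleg x k) <= sqrt 3 * Rabs (c k).
Proof.
  intros Hx. rewrite Rabs_mult. pose proof (wleg_bound x k Hx). pose proof (Rabs_pos (c k)). nra.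
Qed.

Lemma w_legsum n c x : w x * legsum n c x = lsum (seq 0 n) (fun k => c k * wleg x k).
Proof. unfold legsum. rewrite <- lsum_scal. apply lsum_ext; intros; unfold wleg; ring. Qed.

(* If f differed from its Legendre series at x0, the remainders f - S_m, damped by 1 - x^2,
   would stay of one sign near x0 for all large m; a high power of a polynomial peaked at x0
   is orthogonal to f - S_m once m exceeds its degree, which is impossible. *)
Lemma legendre_series_continuous (F : R -> R) x0 :
  (forall x, continuous F x) -> ex_series (fun k => Rabs (coef F k)) -> -1 < x0 < 1 ->
  Series (fun k => coef F k * wleg x0 k) = w x0 * F x0.
Proof.
  intros HF Hs Hx0. set (c := coef F) in *. set (b := fun k => Rabs (c k)) in *.
  assert (Hw : 0 < w x0) by (pose proof (one_minus_sqr_le_w x0 ltac:(lra)); nra).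
  set (l := Series (fun k => c k * wleg x0 k)).
  destruct (Req_dec l (w x0 * F x0)) as [|Hne]; [auto|exfalso].
  (* [v] is the supposed gap at [x0], [sg] its sign, and [eta] the size of the gap after damping. *)
  set (v := F x0 - l / w x0).
  assert (Hv : v <> 0).
  { unfold v. intros H. apply Hne. replace (F x0) with (l / w x0) by lra. field. lra. }
  set (sg := if Rle_dec 0 v then 1 else -1).
  assert (Hsg : sg * v = Rabs v /\ Rabs sg = 1).
  { unfold sg. destruct Rle_dec; split.
    - rewrite Rabs_pos_eq; lra.
    - apply Rabs_R1.
    - rewrite (Rabs_left v); lra.
    - rewrite Rabs_left; lra. }
  destruct Hsg as [Hsgv Hsg1].
  assert (Hq : 0 < 1 - x0 ^ 2) by nra.
  set (eta := Rabs v * (1 - x0 ^ 2)).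
  assert (Heta : 0 < eta) by (apply Rmult_lt_0_compat; [now apply Rabs_pos_lt|lra]).
  set (e := fun m x => sg * (F x - legsum m c x) * (1 - x ^ 2)).
  assert (Ce : forall m x, continuous (e m) x).
  { intros. unfold e. apply @continuous_mult.
    - apply @continuous_mult; [apply continuous_const|].
      apply @continuous_minus; [auto|apply continuous_legsum].
    - apply (ex_derive_continuous (fun x => 1 - x ^ 2)). now auto_derive. }
  assert (Hs3 : 0 < sqrt 3) by (apply sqrt_lt_R0; lra).
  destruct (is_lim_seq_lsum b Hs) with (P := fun y => Rabs (y - Series b) < eta / (10 * sqrt 3)) as [n Hn].
  { exists (mkposreal (eta / (10 * sqrt 3)) ltac:(apply Rdiv_lt_0_compat; lra)). intros y Hy. apply Hy. }
  specialize (Hn n ltac:(lia)). set (N := S n) in *.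
  assert (Htail : sqrt 3 * (Series b - lsum (seq 0 N) b) <= eta / 10).
  { apply Rabs_lt_between in Hn.
    replace (eta / 10) with (sqrt 3 * (eta / (10 * sqrt 3))) by (field; lra).
    apply Rmult_le_compat_l; lra. }
  assert (Hb0 : forall k, 0 <= b k) by (intros; apply Rabs_pos).
  (* From [N] on, the damped remainders agree up to [eta / 10], so bounds for [e N], near [x0] and
     on the whole interval, pass to every later [e m]. *)
  assert (Hdiff : forall m x, (N <= m)%nat -> -1 <= x <= 1 -> Rabs (e m x - e N x) <= eta / 10).
  { intros m x Hm Hx.
    replace (e m x - e N x) with (sg * ((legsum N c x - legsum m c x) * (1 - x ^ 2))) by (unfold e; ring).
    rewrite Rabs_mult, Hsg1, Rmult_1_l, Rabs_mult, (Rabs_pos_eq (1 - x ^ 2)) by nra.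
    pose proof (one_minus_sqr_le_w x Hx).
    apply Rle_trans with (Rabs (legsum N c x - legsum m c x) * w x).
    { apply Rmult_le_compat_l; [apply Rabs_pos|auto]. }
    rewrite Rabs_minus_sym.
    rewrite <- (Rabs_pos_eq (w x)) by apply w_nonneg.
    rewrite <- Rabs_mult.
    replace ((legsum m c x - legsum N c x) * w x) with (w x * legsum m c x - w x * legsum N c x) by ring.
    rewrite !w_legsum.
    eapply Rle_trans; [apply (lsum_diff_le _ b (sqrt 3)); auto; intros; now apply coef_wleg_bound|].
    pose proof (lsum_le_Series b m Hs Hb0). nra. }
  assert (Hcenter : 9 / 10 * eta <= e N x0).
  { pose proof (series_tail_le (fun k => c k * wleg x0 k) b (sqrt 3) N Hs) as Ht.
    specialize (Ht ltac:(intros; apply coef_wleg_bound; lra)). fold l in Ht.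
    rewrite <- w_legsum in Ht.
    assert (Hd : Rabs ((legsum N c x0 - l / w x0) * (1 - x0 ^ 2)) <= eta / 10).
    { rewrite Rabs_mult, (Rabs_pos_eq (1 - x0 ^ 2)) by lra.
      apply Rle_trans with (Rabs (legsum N c x0 - l / w x0) * w x0).
      - apply Rmult_le_compat_l; [apply Rabs_pos|]. apply one_minus_sqr_le_w; lra.
      - rewrite <- (Rabs_pos_eq (w x0)) at 2 by lra. rewrite Rabs_minus_sym, <- Rabs_mult.
        replace ((l / w x0 - legsum N c x0) * w x0) with (l - w x0 * legsum N c x0) by (field; lra).
        lra. }
    replace (e N x0) with (eta - sg * ((legsum N c x0 - l / w x0) * (1 - x0 ^ 2))).
    - assert (Rabs (sg * ((legsum N c x0 - l / w x0) * (1 - x0 ^ 2))) <= eta / 10)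
        by (rewrite Rabs_mult, Hsg1; lra).
      apply Rabs_le_between in H. lra.
    - unfold eta. rewrite <- Hsgv. unfold e, v. ring. }
  assert (Hnear : exists d, 0 < d /\ -1 <= x0 - d /\ x0 + d <= 1 /\
            forall x, Rabs (x - x0) <= d -> 8 / 10 * eta <= e N x).
  { pose proof (Ce N x0) as Hc. apply continuity_pt_filterlim in Hc.
    destruct (Hc (eta / 10) ltac:(lra)) as (d & Hd & Hcd).
    exists (Rmin (d / 2) (Rmin (1 - x0) (1 + x0))).
    pose proof (Rmin_l (d / 2) (Rmin (1 - x0) (1 + x0))). pose proof (Rmin_r (d / 2) (Rmin (1 - x0) (1 + x0))).
    pose proof (Rmin_l (1 - x0) (1 + x0)). pose proof (Rmin_r (1 - x0) (1 + x0)).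
    repeat split; [|lra|lra|].
    - repeat apply Rmin_glb_lt; lra.
    - intros x Hx. destruct (Req_dec x x0) as [->|Hxx]; [lra|].
      assert (Hdx : Rabs (e N x - e N x0) < eta / 10).
      { apply Hcd. split; [split; [exact I|auto]|]. simpl. unfold Rdist. lra. }
      apply Rabs_lt_between in Hdx. lra. }
  destruct Hnear as (d & Hd & Hd1 & Hd2 & Hnear).
  destruct (bounded_on_segment (e N) (-1) 1 ltac:(lra) (Ce N)) as (B & HB & HeB).
  destruct (RInt_mul_peak_pos x0 d (eta / 2) (B + eta / 10) Hd Hd1 Hd2 ltac:(lra) ltac:(lra)) as [j Hj].
  (* Large enough for [Hdiff] and above the degree [2j + 2] of the test polynomial. *)
  set (m := (N + (2 * j + 3))%nat).
  assert (Hpos : 0 < RInt (fun x => e m x * peak x0 d x ^ j) (-1) 1).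
  { apply Hj; [apply Ce| |].
    - intros x Hx Hxd. specialize (Hnear x Hxd). pose proof (Hdiff m x ltac:(unfold m; lia) Hx) as H.
      apply Rabs_le_between in H. lra.
    - intros x Hx. specialize (HeB x Hx). pose proof (Hdiff m x ltac:(unfold m; lia) Hx) as H.
      replace (e m x) with ((e m x - e N x) + e N x) by ring.
      eapply Rle_trans; [apply Rabs_triang|]. lra. }
  rewrite (RInt_ext _ (fun x => sg * ((F x - legsum m c x) * ((1 - x ^ 2) * peak x0 d x ^ j)))) in Hpos.
  2:{ intros x _. unfold e. as_R. ring. }
  rewrite (RInt_scal (V := R_CompleteNormedModule)
    (fun x => (F x - legsum m c x) * ((1 - x ^ 2) * peak x0 d x ^ j))) in Hpos.
  - unfold c in Hpos. rewrite (RInt_remainder_span F (2 * j + 3) m) in Hpos; auto.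
    + unfold scal in Hpos; simpl in Hpos; unfold mult in Hpos; simpl in Hpos. lra.
    + apply in_span_peak.
    + unfold m; lia.
  - apply ex_RInt_cont. intros x. apply @continuous_mult.
    + apply @continuous_minus; [auto|apply continuous_legsum].
    + apply @continuous_mult; [|apply continuous_peak_pow].
      apply (ex_derive_continuous (fun x => 1 - x ^ 2)). now auto_derive.
Qed.

Lemma legendre_series f x :
  cont_on_I f -> ex_series (fun k => Rabs (coef f k)) -> -1 <= x <= 1 ->
  Series (fun k => coef f k * wleg x k) = w x * f x.
Proof.
  intros Hf Hs Hx.
  destruct (Req_dec (1 - x ^ 2) 0) as [E|E].
  - assert (Hw : w x = 0) by (unfold w; rewrite E, !sqrt_0; ring).
    rewrite Hw, Rmult_0_l. rewrite (Series_ext _ (fun k => 0 * L k x)).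
    + rewrite Series_scal_l. ring.
    + intros k. unfold wleg. rewrite Hw. ring.
  - assert (Hc : forall k, coef (fun y => f (clip y)) k = coef f k).
    { intros k. unfold coef. now rewrite (RInt_clip f). }
    replace (f x) with (f (clip x)) by (now rewrite clip_id).
    rewrite <- (legendre_series_continuous (fun y => f (clip y)) x).
    + apply Series_ext. intros k. now rewrite Hc.
    + intros; now apply continuous_clip.
    + apply (ex_series_ext (fun k => Rabs (coef f k))); auto. intros; now rewrite Hc.
    + nra.
Qed.

(** * Sparse approximation and recovery *)

Lemma rpow_nonneg a p : 0 <= rpow a p.
Proof. unfold rpow. destruct Req_EM_T; [lra|left; apply exp_pos]. Qed.

Lemma rpow_0 p : rpow 0 p = 0.
Proof. unfold rpow. destruct Req_EM_T; [reflexivity|lra]. Qed.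

Lemma rpow_pos a p : a <> 0 -> rpow a p = Rpower a p.
Proof. unfold rpow. destruct Req_EM_T; tauto. Qed.

Lemma Rpower_pos x y : 0 < Rpower x y.
Proof. apply exp_pos. Qed.

Lemma Rpower_ge_1 x y : 1 <= x -> 0 <= y -> 1 <= Rpower x y.
Proof. intros Hx Hy. rewrite <- (Rpower_O x) by lra. destruct (Req_dec x 1) as [->|].
  - unfold Rpower. rewrite ln_1, !Rmult_0_r. lra.
  - apply Rle_Rpower; lra.
Qed.

(* Stechkin's estimate, with the largest entries selected by thresholding. *)
Lemma exists_sparse_approximation (c : nat -> R) q s n :
  0 < q < 1 -> 1 <= s -> ex_series (fun k => rpow (Rabs (c k)) q) ->
  exists big : nat -> Prop,
    lsum (seq 0 n) (fun k => indic (big k)) <= s /\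
    lsum (seq 0 n) (fun k => Rabs (c k) * (1 - indic (big k)))
      <= rpow (Series (fun k => rpow (Rabs (c k)) q)) (/ q) * Rpower s (1 - / q).
Proof.
  intros Hq Hs Hex. set (a := fun k => rpow (Rabs (c k)) q) in *. set (A := Series a).
  assert (Ha : forall k, 0 <= a k) by (intros; apply rpow_nonneg).
  assert (HA : forall n, lsum (seq 0 n) a <= A) by (intros; now apply lsum_le_Series).
  assert (HA0 : 0 <= A) by now apply Series_nonneg.
  destruct (Req_dec A 0) as [E|E].
  - assert (Hc : forall k, c k = 0).
    { intros k. destruct (Req_dec (c k) 0) as [|H]; [auto|exfalso].
      assert (a k <= A).
      { eapply Rle_trans; [|apply (HA (S k))]. apply (lsum_term_le (seq 0 (S k)) a); auto.
        apply in_seq; lia. }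
      assert (0 < a k); [|lra].
      unfold a. rewrite rpow_pos by now apply Rabs_no_R0. apply Rpower_pos. }
    exists (fun _ => False). split.
    + rewrite lsum_zero; [lra|]. intros; now rewrite indic_false.
    + rewrite lsum_zero.
      * apply Rmult_le_pos; [apply rpow_nonneg|left; apply Rpower_pos].
      * intros. rewrite Hc, Rabs_R0. ring.
  - assert (HAp : 0 < A) by lra.
    (* By Markov's inequality at most [s] entries exceed [t]; the others satisfy
       [|c_k| <= t^(1-q) |c_k|^q], with sum at most [t^(1-q) A = A^(1/q) s^(1-1/q)]. *)
    set (t := Rpower (A / s) (/ q)).
    assert (Ht : 0 < t) by apply Rpower_pos.
    assert (HAs : 0 < A / s) by (apply Rdiv_lt_0_compat; lra).
    assert (Htq : Rpower t q = A / s).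
    { unfold t. rewrite Rpower_mult, Rinv_l, Rpower_1; lra. }
    exists (fun k => t < Rabs (c k)). split.
    + apply Rmult_le_reg_r with (A / s); [lra|].
      replace (s * (A / s)) with A by (field; lra).
      eapply Rle_trans; [|apply (HA n)].
      rewrite Rmult_comm, <- lsum_scal. apply lsum_le; intros k _.
      unfold indic; destruct excluded_middle_informative as [Hk|Hk].
      * unfold a. rewrite rpow_pos by lra. rewrite <- Htq, Rmult_1_r.
        apply Rle_Rpower_l; lra.
      * rewrite Rmult_0_r. apply Ha.
    + rewrite rpow_pos by lra.
      assert (Hfin : Rpower t (1 - q) * A = Rpower A (/ q) * Rpower s (1 - / q)).
      { unfold t. rewrite Rpower_mult. unfold Rpower.
        replace A with (exp (ln A)) at 2 by (now apply exp_ln).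
        unfold Rdiv. rewrite ln_mult, ln_Rinv by (try apply Rinv_0_lt_compat; lra).
        rewrite <- !exp_plus. f_equal. field. lra. }
      rewrite <- Hfin. eapply Rle_trans; [|apply Rmult_le_compat_l; [left; apply Rpower_pos|apply (HA n)]].
      rewrite <- lsum_scal. apply lsum_le; intros k _.
      unfold indic; destruct excluded_middle_informative as [Hk|Hk].
      * rewrite Rminus_diag, Rmult_0_r. apply Rmult_le_pos; [left; apply Rpower_pos|apply Ha].
      * rewrite Rminus_0_r, Rmult_1_r. apply Rnot_lt_le in Hk. unfold a.
        destruct (Req_dec (Rabs (c k)) 0) as [E0|E0]; [rewrite E0, rpow_0; lra|].
        pose proof (Rabs_pos (c k)). rewrite rpow_pos by auto.
        replace (Rabs (c k)) with (Rpower (Rabs (c k)) (1 - q) * Rpower (Rabs (c k)) q) at 1.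
        -- apply Rmult_le_compat_r; [left; apply Rpower_pos|]. apply Rle_Rpower_l; lra.
        -- rewrite <- Rpower_plus. replace (1 - q + q) with 1 by ring. apply Rpower_1. lra.
Qed.

(** Unless the entries off [big] carry half of [|c|_1], Cauchy-Schwarz on the at most [2s] entries
    of [big] gives [|c|_1^2 <= 8 s |c|_2^2]. Then [|c|_2^2 / 64 >= |c|_1^2 / (512 s)] is at least
    twice the defect, as [2^J >= 1024 s], and [|c|_1^2 <= 1024 s tau^2] follows. *)
Lemma robust_null_space {X} (a : X -> nat -> R) n (xs : list X) J s (c : nat -> R) (big : nat -> Prop) tau :
  xs <> nil -> 0 < s -> 1024 * s <= 2 ^ J -> 0 <= tau ->
  lsum (seq 0 n) (fun k => c k ^ 2) / 64 - l1 n c ^ 2 / 2 ^ J <= avg xs (fun x => form a n c x ^ 2) ->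
  lsum (seq 0 n) (fun k => indic (big k)) <= 2 * s ->
  (forall x, In x xs -> Rabs (form a n c x) <= tau) ->
  l1 n c <= 2 * lsum (seq 0 n) (fun k => Rabs (c k) * (1 - indic (big k))) + 32 * sqrt s * tau.
Proof.
  intros Hxs Hs HJ Htau Hlow Hbig Hsamp.
  set (sigma := lsum (seq 0 n) (fun k => Rabs (c k) * (1 - indic (big k)))).
  set (Q := lsum (seq 0 n) (fun k => c k ^ 2)) in *.
  assert (Hst : 0 <= sqrt s * tau) by (apply Rmult_le_pos; [apply sqrt_pos|auto]).
  destruct (Rle_dec (l1 n c) (2 * sigma)) as [|Hl]; [lra|].
  assert (Hl1 : 0 <= l1 n c) by (apply lsum_nonneg; intros; apply Rabs_pos).
  assert (Hsplit : l1 n c = lsum (seq 0 n) (fun k => Rabs (c k) * indic (big k)) + sigma).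
  { unfold l1, sigma. rewrite <- lsum_plus. apply lsum_ext; intros; ring. }
  assert (Hcs : l1 n c ^ 2 <= 8 * s * Q).
  { pose proof (lsum_cauchy_schwarz (seq 0 n) (fun k => Rabs (c k)) (fun k => indic (big k))) as H.
    rewrite (lsum_ext _ (fun k => Rabs (c k) ^ 2) (fun k => c k ^ 2)) in H by (intros; apply pow2_abs).
    rewrite (lsum_ext _ (fun k => indic (big k) ^ 2) (fun k => indic (big k))) in H.
    2:{ intros k _. unfold indic; destruct excluded_middle_informative; ring. }
    fold Q in H.
    set (S1 := lsum (seq 0 n) (fun k => Rabs (c k) * indic (big k))) in *.
    assert (0 <= Q) by (apply lsum_nonneg; intros; apply pow2_ge_0).
    assert (Rsqr S1 <= Q * (2 * s)).
    { eapply Rle_trans; [exact H|]. now apply Rmult_le_compat_l. }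
    unfold Rsqr in *. assert (l1 n c <= 2 * S1) by lra. nra. }
  assert (Havg : avg xs (fun x => form a n c x ^ 2) <= tau ^ 2).
  { eapply Rle_trans; [apply (avg_le xs _ (fun _ => tau ^ 2))|].
    - intros x Hx. rewrite <- pow2_abs. apply pow_incr. split; [apply Rabs_pos|auto].
    - unfold avg. rewrite lsum_const. right. field.
      pose proof (length_pos_of_not_nil xs Hxs). lra. }
  assert (HJ2 : l1 n c ^ 2 / 2 ^ J <= l1 n c ^ 2 / (1024 * s)).
  { apply Rmult_le_compat_l; [apply pow2_ge_0|]. apply Rinv_le_contravar; lra. }
  assert (HQ : l1 n c ^ 2 / (512 * s) <= Q / 64).
  { apply Rmult_le_reg_r with (512 * s); [lra|].
    replace (l1 n c ^ 2 / (512 * s) * (512 * s)) with (l1 n c ^ 2) by (field; lra). lra. }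
  assert (Hfin : l1 n c ^ 2 <= 1024 * s * tau ^ 2).
  { assert (l1 n c ^ 2 / (1024 * s) <= tau ^ 2).
    { replace (l1 n c ^ 2 / (1024 * s)) with (l1 n c ^ 2 / (512 * s) - l1 n c ^ 2 / (1024 * s)) by (field; lra).
      lra. }
    apply Rmult_le_reg_r with (/ (1024 * s)); [apply Rinv_0_lt_compat; lra|].
    replace (1024 * s * tau ^ 2 * / (1024 * s)) with (tau ^ 2) by (field; lra). exact H. }
  assert (l1 n c <= 32 * (sqrt s * tau)).
  { apply Rsqr_incr_0_var; [|lra]. unfold Rsqr.
    replace (32 * (sqrt s * tau) * (32 * (sqrt s * tau))) with (1024 * (sqrt s * sqrt s) * tau ^ 2) by ring.
    rewrite sqrt_sqrt by lra. lra. }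
  assert (0 <= sigma).
  { apply lsum_nonneg; intros k _. pose proof (indic_bounds (big k)).
    apply Rmult_le_pos; [apply Rabs_pos|lra]. }
  lra.
Qed.

Lemma series_tail_le_of_partial (a : nat -> R) n Y : ex_series a ->
  (forall N, (n <= N)%nat -> lsum (seq 0 N) a - lsum (seq 0 n) a <= Y) ->
  Series a - lsum (seq 0 n) a <= Y.
Proof.
  intros Ha H.
  apply (is_lim_seq_le_loc (fun N => lsum (seq 0 (S N)) a - lsum (seq 0 n) a) (fun _ => Y)
    (Series a - lsum (seq 0 n) a) Y).
  - exists n. intros N HN. apply H. lia.
  - apply is_lim_seq_minus'; [now apply is_lim_seq_lsum|apply is_lim_seq_const].
  - apply is_lim_seq_const.
Qed.

Lemma lsum_seq_split (a : nat -> R) n N : (n <= N)%nat ->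
  lsum (seq 0 N) a - lsum (seq 0 n) a = lsum (seq n (N - n)) a.
Proof.
  intros H. replace N with (n + (N - n))%nat at 1 by lia.
  rewrite seq_app, lsum_app. simpl. ring.
Qed.

Lemma ex_series_coef alpha f : 0 < alpha -> in_A1alpha alpha f -> ex_series (fun k => Rabs (coef f k)).
Proof.
  intros Ha [_ H]. apply (ex_series_dominated _ _ 1 H). intros k.
  rewrite Rabs_Rabsolu, Rmult_1_l. pose proof (Rabs_pos (coef f k)).
  assert (1 <= Rpower (1 + INR k) alpha) by (apply Rpower_ge_1; [pose proof (pos_INR k)|]; lra). nra.
Qed.

Lemma A1alpha_term_nonneg alpha f k : 0 <= Rpower (1 + INR k) alpha * Rabs (coef f k).
Proof. apply Rmult_le_pos; [left; apply Rpower_pos|apply Rabs_pos]. Qed.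

(** The first omitted degree is [D + 1], whose weight in the norm is [(D + 2)^alpha]. *)
Lemma coef_tail_le alpha f D : 0 < alpha -> in_A1alpha alpha f ->
  Series (fun k => Rabs (coef f k)) - lsum (seq 0 (S D)) (fun k => Rabs (coef f k))
  <= Rpower (INR D + 2) (- alpha) * norm_A1alpha alpha f.
Proof.
  intros Ha Hf. pose proof Hf as [_ Hex].
  apply series_tail_le_of_partial; [now apply (ex_series_coef alpha)|].
  intros N HN. rewrite lsum_seq_split by auto.
  set (b := fun k => Rpower (1 + INR k) alpha * Rabs (coef f k)).
  apply Rle_trans with (Rpower (INR D + 2) (- alpha) * lsum (seq (S D) (N - S D)) b).
  - rewrite <- lsum_scal. apply lsum_le. intros k Hk. apply in_seq in Hk. unfold b.
    rewrite <- Rmult_assoc. rewrite <- (Rmult_1_l (Rabs (coef f k))) at 1.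
    apply Rmult_le_compat_r; [apply Rabs_pos|].
    pose proof (pos_INR D) as HD.
    assert (HkD : INR D + 2 <= 1 + INR k).
    { assert (HS : INR (S D) <= INR k) by (apply le_INR; lia). rewrite S_INR in HS. lra. }
    apply Rle_trans with (Rpower (INR D + 2) (- alpha) * Rpower (INR D + 2) alpha).
    + rewrite <- Rpower_plus. replace (- alpha + alpha) with 0 by ring. rewrite Rpower_O; lra.
    + apply Rmult_le_compat_l; [left; apply Rpower_pos|]. apply Rle_Rpower_l; lra.
  - apply Rmult_le_compat_l; [left; apply Rpower_pos|].
    rewrite <- lsum_seq_split by auto.
    assert (0 <= lsum (seq 0 (S D)) b) by (apply lsum_nonneg; intros; apply A1alpha_term_nonneg).
    pose proof (lsum_le_Series b N Hex (A1alpha_term_nonneg alpha f)). unfold norm_A1alpha. fold b. lra.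
Qed.

(** If no element were minimal up to the factor 2, the values could be halved forever, against the
    lower bound [b > 0]. *)
Lemma exists_near_minimizer {T} (E : T -> Prop) (nu : T -> R) b :
  0 < b -> (exists t, E t) -> (forall t, E t -> b <= nu t) ->
  exists t0, E t0 /\ forall t, E t -> nu t0 <= 2 * nu t.
Proof.
  intros Hb [t1 H1] Hlow. apply NNPP. intros Hno.
  assert (Hstep : forall n, exists t, E t /\ 2 ^ n * nu t <= nu t1).
  { induction n as [|n (t & Ht & Hle)]; [exists t1; simpl; split; [auto|lra]|].
    destruct (classic (exists t', E t' /\ 2 * nu t' < nu t)) as [(t' & Ht' & Hlt)|Hn].
    - exists t'; split; auto. simpl. pose proof (pow_lt 2 n). nra.
    - exfalso. apply Hno. exists t; split; auto. intros t' Ht'.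
      apply Rnot_lt_le. intros Hlt. apply Hn. eauto. }
  destruct (INR_unbounded (nu t1 / b)) as [n Hn].
  destruct (Hstep n) as (t & Ht & Hle). specialize (Hlow t Ht).
  assert (Hpow : INR n <= 2 ^ n).
  { rewrite <- pow_INR_2. apply le_INR. pose proof (Nat.pow_gt_lin_r 2 n). lia. }
  assert (nu t1 < INR n * b).
  { apply Rmult_lt_reg_r with (/ b); [now apply Rinv_0_lt_compat|].
    replace (INR n * b * / b) with (INR n) by (field; lra). exact Hn. }
  assert (INR n * b <= 2 ^ n * nu t).
  { apply Rmult_le_compat; auto; [apply pos_INR|lra]. }
  lra.
Qed.

Lemma weighted_value_bound f x : cont_on_I f -> ex_series (fun k => Rabs (coef f k)) -> -1 <= x <= 1 ->
  Rabs (w x * f x) <= sqrt 3 * norm_A1 f.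
Proof.
  intros Hf Hs Hx. rewrite <- legendre_series by auto.
  pose proof (series_tail_le (fun k => coef f k * wleg x k) (fun k => Rabs (coef f k)) (sqrt 3) 0 Hs
    (fun k => coef_wleg_bound _ x k Hx)) as H.
  simpl in H. rewrite !Rminus_0_r in H. exact H.
Qed.

Lemma norm_inf_w_le g : cont_on_I g -> ex_series (fun k => Rabs (coef g k)) ->
  Rbar_le (Rbar_mult (Finite (/ sqrt 3)) (norm_inf_w g)) (Finite (norm_A1 g)).
Proof.
  intros Hg Hs.
  assert (H3 : 0 < sqrt 3) by (apply sqrt_lt_R0; lra).
  unfold norm_inf_w.
  destruct (Lub_Rbar_correct (fun y => exists x, -1 <= x <= 1 /\ y = Rabs (g x) * w x)) as [Hub Hlub].
  set (l := Lub_Rbar _) in *.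
  assert (H1 : Rbar_le l (Finite (sqrt 3 * norm_A1 g))).
  { apply Hlub. intros y (x & Hx & ->). simpl.
    rewrite <- (Rabs_pos_eq (w x)) by apply w_nonneg. rewrite <- Rabs_mult, Rmult_comm.
    now apply weighted_value_bound. }
  (* The value at 0 keeps the supremum from being [m_infty]. *)
  assert (H0 : Rbar_le (Finite (Rabs (g 0) * w 0)) l).
  { apply Hub. exists 0; split; [lra|reflexivity]. }
  destruct l as [r| |]; simpl in *; try easy.
  apply Rmult_le_reg_l with (sqrt 3); [auto|]. rewrite <- Rmult_assoc, Rinv_r by lra. lra.
Qed.

(** * Reconstruction from a near-minimal function with the same data *)

Section Recovery.

Context (q alpha : R) (Hq : 0 < q < 1) (Halpha : 0 < alpha).

Definition admissible (f : R -> R) : Prop := in_Ap q f /\ in_A1alpha alpha f.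

(** For [q < 1] the first summand is only a quasi-norm; the estimates carry [nu f + nu f0] and never
    form [nu] of a difference. *)
Definition nu (f : R -> R) : R := norm_Ap q f + norm_A1alpha alpha f.

Lemma norm_Ap_nonneg f : 0 <= norm_Ap q f.
Proof. apply rpow_nonneg. Qed.

Lemma norm_A1_le f : admissible f -> norm_A1 f <= norm_A1alpha alpha f.
Proof.
  intros [_ Hf]. pose proof Hf as [_ Hex].
  apply Series_le; auto. intros k. split; [apply Rabs_pos|].
  pose proof (Rabs_pos (coef f k)).
  assert (1 <= Rpower (1 + INR k) alpha) by (apply Rpower_ge_1; [pose proof (pos_INR k)|]; lra). nra.
Qed.

Lemma norm_A1_le_nu f : admissible f -> norm_A1 f <= nu f.
Proof. intros Hf. pose proof (norm_A1_le f Hf). pose proof (norm_Ap_nonneg f). unfold nu. lra. Qed.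

Lemma nu_nonneg f : admissible f -> 0 <= nu f.
Proof.
  intros Hf. eapply Rle_trans; [|apply (norm_A1_le_nu f Hf)].
  apply Series_nonneg; [|intros; apply Rabs_pos]. apply (ex_series_coef alpha); [auto|apply Hf].
Qed.

Lemma admissible_zero : admissible (fun _ => 0) /\ nu (fun _ => 0) = 0.
Proof.
  assert (Hc : forall k, coef (fun _ => 0) k = 0).
  { intros k. unfold coef. rewrite (RInt_ext _ (fun _ => 0)) by (intros; as_R; ring).
    rewrite RInt_const. unfold scal; simpl; unfold mult; simpl. ring. }
  assert (Hcont : cont_on_I (fun _ => 0)) by (apply cont_on_I_of_continuous; intros; apply continuous_const).
  assert (Hz : ex_series (fun _ : nat => 0) /\ Series (fun _ : nat => 0) = 0).
  { assert (H : is_series (fun _ : nat => 0) 0).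
    { apply (filterlim_ext (fun _ : nat => 0)); [|apply filterlim_const].
      intros n. rewrite sum_n_lsum. symmetry. now apply lsum_zero. }
    split; [now exists 0|now apply is_series_unique]. }
  assert (H1 : forall k, rpow (Rabs (coef (fun _ => 0) k)) q = 0) by (intros; rewrite Hc, Rabs_R0; apply rpow_0).
  assert (H2 : forall k, Rpower (1 + INR k) alpha * Rabs (coef (fun _ => 0) k) = 0)
    by (intros; rewrite Hc, Rabs_R0; ring).
  split.
  - split; split; auto; apply (ex_series_ext (fun _ => 0)); try apply Hz; intros; auto.
  - unfold nu, norm_Ap, norm_A1alpha.
    rewrite (Series_ext _ (fun _ => 0) H1), (Series_ext _ (fun _ => 0) H2), (proj2 Hz), rpow_0. ring.
Qed.

(* Samples are compared after weighting, so that zero data admit the zero function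
   even when an endpoint, where w vanishes, is sampled. *)
Definition stable (D : nat) (xs : list R) (K B : R) : Prop :=
  (forall f, admissible f ->
     norm_A1 f - lsum (seq 0 (S D)) (fun k => Rabs (coef f k)) <= nu f * B) /\
  (forall f f0, admissible f -> admissible f0 -> (forall x, In x xs -> w x * f x = w x * f0 x) ->
     l1 (S D) (fun k => coef f k - coef f0 k) <= K * (nu f + nu f0) * B).

(** The polynomial truncates a near-minimal [f0]. Since [nu f0 <= 2 * nu f], the head costs
    [3 * K * nu f * B], and the tail of [f] another [nu f * B]. *)
Lemma recovery_of_stable D N xs K B : (D <= N)%nat -> 0 <= K -> 0 <= B ->
  (forall x, In x xs -> -1 <= x <= 1) -> stable D xs K B ->
  exists Rec : list R -> nat -> R, forall f, in_Ap q f -> in_A1alpha alpha f ->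
    let P := poly_eval N (Rec (map f xs)) in
    let g := fun x => f x - P x in
    ex_series (fun k => Rabs (coef g k)) /\
    Rbar_le (Rbar_mult (Finite (/ sqrt 3)) (norm_inf_w g)) (Finite (norm_A1 g)) /\
    norm_A1 g <= (3 * K + 1) * nu f * B.
Proof.
  intros HDN HK HB Hxs [Htail Hstab].
  set (data := fun ys f => admissible f /\
     forall i, (i < length xs)%nat -> w (nth i xs 0) * f (nth i xs 0) = w (nth i xs 0) * nth i ys 0).
  assert (Hnear : forall ys, exists f0, (exists f, data ys f) ->
             data ys f0 /\ forall f, data ys f -> nu f0 <= 2 * nu f).
  (* Data that no admissible function fits receive the zero function, so that the map is total. *)
  { intros ys. destruct (classic (exists f, data ys f)) as [Hex|]; [|exists (fun _ => 0); tauto].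
    destruct (classic (exists i, (i < length xs)%nat /\ w (nth i xs 0) * nth i ys 0 <> 0)) as [(i & Hi & Hne)|Hz].
    (* A nonzero weighted datum [v] forces [nu f >= |v| / sqrt 3], the positive bound that
       [exists_near_minimizer] requires. If all vanish, the zero function fits, with [nu] equal to
       0. *)
    - set (v := w (nth i xs 0) * nth i ys 0) in *.
      assert (H3 : 0 < sqrt 3) by (apply sqrt_lt_R0; lra).
      destruct (exists_near_minimizer (data ys) nu (Rabs v / sqrt 3)) as (f0 & H0 & Hmin); auto.
      + apply Rdiv_lt_0_compat; [now apply Rabs_pos_lt|auto].
      + intros f [Hf Hfx]. eapply Rle_trans; [|now apply norm_A1_le_nu].
        apply Rmult_le_reg_l with (sqrt 3); [auto|].
        replace (sqrt 3 * (Rabs v / sqrt 3)) with (Rabs v) by (field; lra).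
        unfold v. rewrite <- Hfx by auto. apply weighted_value_bound.
        * apply Hf.
        * apply (ex_series_coef alpha); [auto|apply Hf].
        * apply Hxs, nth_In; auto.
      + exists f0. auto.
    - exists (fun _ => 0). intros _. destruct admissible_zero as [Hadm Hnu]. split.
      + split; auto. intros i Hi. rewrite Rmult_0_r.
        destruct (Req_dec (w (nth i xs 0) * nth i ys 0) 0) as [E|E]; [auto|exfalso; eauto].
      + intros f [Hf _]. rewrite Hnu. pose proof (nu_nonneg f Hf). lra. }
  (* Coefficients and [f0] share one existential, so that choice yields [Rec] as a function of the
     data alone. *)
  assert (Hrec : forall ys, exists a, exists f0, (forall x, poly_eval N a x = legsum (S D) (coef f0) x) /\
     ((exists f, data ys f) -> data ys f0 /\ forall f, data ys f -> nu f0 <= 2 * nu f)).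
  { intros ys. destruct (Hnear ys) as [f0 H0]. destruct (is_poly_legsum N D (coef f0) HDN) as [a Ha].
    exists a, f0. auto. }
  exists (fun ys => proj1_sig (constructive_indefinite_description _ (Hrec ys))).
  intros f Hf1 Hf2. assert (Hf : admissible f) by (split; auto).
  cbv zeta. set (ys := map f xs).
  destruct constructive_indefinite_description as [a (f0 & Ha & H0)]. simpl proj1_sig.
  assert (Hys : data ys f).
  { split; auto. intros i Hi. f_equal. unfold ys.
    rewrite (nth_indep (map f xs) 0 (f 0)) by (rewrite length_map; auto).
    symmetry; apply map_nth. }
  destruct (H0 (ex_intro _ f Hys)) as [[Hf0 Hf0x] Hmin]. specialize (Hmin f Hys).
  replace (poly_eval N a) with (legsum (S D) (coef f0)) by (apply functional_extensionality; auto).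
  set (g := fun x => f x - legsum (S D) (coef f0) x).
  assert (Hcf : cont_on_I f) by apply Hf1.
  assert (Hcg : forall k, coef g k = if lt_dec k (S D) then coef f k - coef f0 k else coef f k).
  { intros k. unfold g. rewrite coef_minus, coef_legsum; auto using continuous_legsum.
    destruct lt_dec; ring. }
  assert (Hsf : ex_series (fun k => Rabs (coef f k))) by now apply (ex_series_coef alpha).
  assert (Hsf0 : ex_series (fun k => Rabs (coef f0 k))) by (apply (ex_series_coef alpha); [auto|apply Hf0]).
  assert (Hsg : ex_series (fun k => Rabs (coef g k))).
  { apply (ex_series_dominated _ (fun k => Rabs (coef f k) + Rabs (coef f0 k)) 1).
    - now apply (ex_series_plus (V := R_NormedModule)).
    - intros k. rewrite Rabs_Rabsolu, Hcg, Rmult_1_l. destruct lt_dec.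
      + unfold Rminus. eapply Rle_trans; [apply Rabs_triang|]. rewrite Rabs_Ropp. lra.
      + pose proof (Rabs_pos (coef f0 k)). lra. }
  assert (Hgc : cont_on_I g).
  { intros x Hx eps Heps.
    destruct (Hcf x Hx (eps / 2) ltac:(lra)) as (d1 & Hd1 & H1).
    destruct (cont_on_I_of_continuous _ (continuous_legsum (S D) (coef f0)) x Hx (eps / 2) ltac:(lra))
      as (d2 & Hd2 & H2).
    exists (Rmin d1 d2). split; [now apply Rmin_glb_lt|]. intros y Hy Hyx.
    pose proof (Rmin_l d1 d2). pose proof (Rmin_r d1 d2).
    specialize (H1 y Hy ltac:(lra)). specialize (H2 y Hy ltac:(lra)). unfold g.
    apply Rabs_lt_between in H1. apply Rabs_lt_between in H2. apply Rabs_lt_between. lra. }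
  split; [exact Hsg|split; [now apply norm_inf_w_le|]].
  assert (Hhead : lsum (seq 0 (S D)) (fun k => Rabs (coef g k)) = l1 (S D) (fun k => coef f k - coef f0 k)).
  { apply lsum_ext; intros k Hk. apply in_seq in Hk. rewrite Hcg. destruct lt_dec; [reflexivity|lia]. }
  assert (Htl : norm_A1 g - lsum (seq 0 (S D)) (fun k => Rabs (coef g k)) <= nu f * B).
  { eapply Rle_trans; [|apply (Htail f Hf)].
    apply series_tail_le_of_partial; auto. intros M HM.
    rewrite lsum_seq_split by auto.
    rewrite (lsum_ext _ _ (fun k => Rabs (coef f k))).
    - rewrite <- lsum_seq_split by auto.
      pose proof (lsum_le_Series (fun k => Rabs (coef f k)) M Hsf ltac:(intros; apply Rabs_pos)).
      unfold norm_A1. lra.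
    - intros k Hk. apply in_seq in Hk. rewrite Hcg. destruct lt_dec; [lia|reflexivity]. }
  assert (Hst : l1 (S D) (fun k => coef f k - coef f0 k) <= K * (nu f + nu f0) * B).
  { apply Hstab; auto. intros x Hx. apply (In_nth _ _ 0) in Hx as (i & Hi & <-).
    rewrite Hf0x by auto. now apply Hys. }
  assert (K * (nu f + nu f0) * B <= K * (3 * nu f) * B).
  { apply Rmult_le_compat_r; auto. apply Rmult_le_compat_l; auto. lra. }
  lra.
Qed.

End Recovery.

(** * Stability of the samples *)

Section Stability.

Context (q alpha s : R) (Hq : 0 < q < 1) (Halpha : 0 < alpha) (Hs : 1 <= s).

Let beta := (/ q - / 2) / alpha.

Lemma tail_le D f : Rpower s beta <= INR D + 2 -> admissible q alpha f ->
  norm_A1 f - lsum (seq 0 (S D)) (fun k => Rabs (coef f k)) <= nu q alpha f * Rpower s (/ 2 - / q).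
Proof.
  intros HD Hf. eapply Rle_trans; [apply coef_tail_le; [exact Halpha|apply Hf]|].
  assert (Hp : Rpower (INR D + 2) (- alpha) <= Rpower s (/ 2 - / q)).
  { unfold Rpower. apply exp_le_mono.
    assert (Hl : beta * ln s <= ln (INR D + 2)).
    { replace (beta * ln s) with (ln (Rpower s beta)) by apply ln_exp.
      apply ln_le; [apply Rpower_pos|auto]. }
    replace ((/ 2 - / q) * ln s) with (- alpha * (beta * ln s)) by (unfold beta; field; lra). nra. }
  assert (H0 : 0 <= norm_A1alpha alpha f).
  { apply Series_nonneg; [apply Hf|]. intros; apply A1alpha_term_nonneg. }
  assert (Hn : norm_A1alpha alpha f <= nu q alpha f) by (unfold nu; pose proof (norm_Ap_nonneg q f); lra).
  rewrite Rmult_comm. apply Rmult_le_compat; auto. left; apply Rpower_pos.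
Qed.

(** Equal weighted samples cancel, so the difference of the truncated series at [x] is a difference
    of two tails beyond degree [D]. *)
Lemma sample_mismatch_le D f f0 x : Rpower s beta <= INR D + 2 ->
  admissible q alpha f -> admissible q alpha f0 -> -1 <= x <= 1 -> w x * f x = w x * f0 x ->
  Rabs (form wleg (S D) (fun k => coef f k - coef f0 k) x)
    <= sqrt 3 * (nu q alpha f + nu q alpha f0) * Rpower s (/ 2 - / q).
Proof.
  intros HD Hf Hf0 Hx Heq.
  assert (Htl : forall h, admissible q alpha h ->
    Rabs (w x * h x - form wleg (S D) (coef h) x) <= sqrt 3 * (nu q alpha h * Rpower s (/ 2 - / q))).
  { intros h Hh. assert (Hsum : ex_series (fun k => Rabs (coef h k)))
      by (apply (ex_series_coef alpha); [auto|apply Hh]).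
    rewrite <- legendre_series; [|apply Hh|auto|auto].
    eapply Rle_trans; [apply (series_tail_le _ (fun k => Rabs (coef h k)) (sqrt 3) (S D)); auto;
      intros; now apply coef_wleg_bound|].
    apply Rmult_le_compat_l; [apply sqrt_pos|]. now apply tail_le. }
  pose proof (Htl f Hf) as T1. pose proof (Htl f0 Hf0) as T2.
  assert (Hform : form wleg (S D) (fun k => coef f k - coef f0 k) x =
    form wleg (S D) (coef f) x - form wleg (S D) (coef f0) x).
  { unfold form. rewrite <- lsum_minus. apply lsum_ext; intros; ring. }
  rewrite Hform.
  replace (sqrt 3 * (nu q alpha f + nu q alpha f0) * Rpower s (/ 2 - / q)) with
    (sqrt 3 * (nu q alpha f * Rpower s (/ 2 - / q)) + sqrt 3 * (nu q alpha f0 * Rpower s (/ 2 - / q))) by ring.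
  apply Rabs_le_between in T1. apply Rabs_le_between in T2. apply Rabs_le_between. lra.
Qed.

(** The factor [sqrt s] from the null space estimate turns the tail rate into the claimed rate; this
    fixes the exponent in [N]. *)
Lemma sqrt_mul_Rpower : sqrt s * Rpower s (/ 2 - / q) = Rpower s (1 - / q).
Proof. rewrite <- Rpower_sqrt, <- Rpower_plus by lra. f_equal. lra. Qed.

Lemma Rpower_half_le : Rpower s (/ 2 - / q) <= Rpower s (1 - / q).
Proof.
  rewrite <- sqrt_mul_Rpower. rewrite <- (Rmult_1_l (Rpower s (/ 2 - / q))) at 1.
  apply Rmult_le_compat_r; [left; apply Rpower_pos|]. rewrite <- sqrt_1. now apply sqrt_le_1_alt.
Qed.

Lemma tail_le_rate D f : Rpower s beta <= INR D + 2 -> admissible q alpha f ->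
  norm_A1 f - lsum (seq 0 (S D)) (fun k => Rabs (coef f k)) <= nu q alpha f * Rpower s (1 - / q).
Proof.
  intros HD Hf. eapply Rle_trans; [now apply tail_le|].
  apply Rmult_le_compat_l; [now apply nu_nonneg|apply Rpower_half_le].
Qed.

Lemma sqrt3_le_2 : sqrt 3 <= 2.
Proof. apply Rsqr_incr_0_var; [|lra]. rewrite Rsqr_sqrt by lra. unfold Rsqr; lra. Qed.

(** For [s = 1] the logarithm vanishes and [m = 0] is allowed, but the rate is 1, and the constant
    coefficients are bounded by [nu] directly. *)
Lemma stable_no_sample : s = 1 -> stable q alpha 0 nil 66 (Rpower s (1 - / q)).
Proof.
  intros E. assert (HB : forall t, Rpower s t = 1) by (intros; rewrite E; unfold Rpower; rewrite ln_1, Rmult_0_r; apply exp_0).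
  split.
  - intros f Hf. apply tail_le_rate; auto. rewrite HB. simpl. lra.
  - intros f f0 Hf Hf0 _. rewrite HB.
    assert (Hc : forall h, admissible q alpha h -> Rabs (coef h 0) <= nu q alpha h).
    { intros h Hh. eapply Rle_trans; [|now apply norm_A1_le_nu].
      assert (Hsum : ex_series (fun k => Rabs (coef h k))) by (apply (ex_series_coef alpha); [auto|apply Hh]).
      pose proof (lsum_le_Series _ 1 Hsum ltac:(intros; apply Rabs_pos)) as H. simpl in H.
      unfold norm_A1. lra. }
    pose proof (Hc f Hf). pose proof (Hc f0 Hf0).
    unfold l1; simpl. assert (Rabs (coef f 0 - coef f0 0) <= Rabs (coef f 0) + Rabs (coef f0 0)).
    { unfold Rminus. eapply Rle_trans; [apply Rabs_triang|]. rewrite Rabs_Ropp. lra. }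
    pose proof (Rabs_pos (coef f 0)). pose proof (Rabs_pos (coef f0 0)). lra.
Qed.

(** For small [beta] the lower bound on [m] may permit a single sample. But then degree 0 already
    leaves tails of the required size, and [w 0 * L 0 0 >= 1] lets the sample at 0 control the
    constant coefficient. *)
Lemma stable_center_sample : Rpower s beta <= 2 -> stable q alpha 0 (0 :: nil) 66 (Rpower s (1 - / q)).
Proof.
  intros HD. assert (HD0 : Rpower s beta <= INR 0 + 2) by (simpl; lra). split.
  - intros f Hf. now apply tail_le_rate.
  - intros f f0 Hf Hf0 Heq.
    pose proof (sample_mismatch_le 0 f f0 0 HD0 Hf Hf0 ltac:(lra) (Heq 0 (or_introl eq_refl))) as H.
    unfold form in H; simpl in H. rewrite Rplus_0_r in H. unfold l1; simpl. rewrite Rplus_0_r.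
    set (u := coef f 0 - coef f0 0) in *.
    assert (Hw : 1 <= wleg 0 0).
    { unfold wleg, L. simpl. rewrite Rmult_0_r, Rplus_0_l, sqrt_1.
      pose proof (one_minus_sqr_le_w 0 ltac:(lra)). lra. }
    rewrite Rabs_mult, (Rabs_pos_eq (wleg 0 0)) in H by lra.
    pose proof (Rabs_pos u). pose proof Rpower_half_le. pose proof sqrt3_le_2. pose proof (sqrt_pos 3).
    pose proof (nu_nonneg q alpha Halpha f Hf). pose proof (nu_nonneg q alpha Halpha f0 Hf0).
    set (V := nu q alpha f + nu q alpha f0) in *. pose proof (Rpower_pos s (/ 2 - / q)).
    assert (Rabs u <= Rabs u * wleg 0 0) by nra.
    assert (sqrt 3 * V * Rpower s (/ 2 - / q) <= 2 * V * Rpower s (1 - / q)).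
    { apply Rmult_le_compat; try lra.
      - apply Rmult_le_pos; unfold V; lra.
      - apply Rmult_le_compat_r; unfold V; lra. }
    pose proof (Rpower_pos s (1 - / q)).
    assert (0 <= V * Rpower s (1 - / q)) by (apply Rmult_le_pos; unfold V; lra). lra.
Qed.

Lemma exists_stable_sample D J h m : Rpower s beta <= INR D + 2 -> 1024 * s <= 2 ^ J ->
  (2 * S D <= 2 ^ h)%nat -> (2 * 2 ^ J * (J + 2) * (1024 * h * (J + 2) + 1) <= m)%nat ->
  exists xs, length xs = m /\ (forall x, In x xs -> -1 <= x <= 1) /\
    stable q alpha D xs 66 (Rpower s (1 - / q)).
Proof.
  intros HD HJ Hh Hm. set (n := S D) in *.
  destruct (exists_frame n) as (Om & HOm & HOm1 & Hframe).
  destruct (restricted_lower_bound wleg n Om J h m HOm) as (xs & Hlen & Hincl & Hlow); auto.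
  { intros x k Hx _. eapply Rle_trans; [apply wleg_bound; auto|apply sqrt3_le_2]. }
  exists xs. repeat split; auto; [apply HOm1; auto|apply HOm1; auto| |].
  - intros f Hf. now apply tail_le_rate.
  - intros f f0 Hf Hf0 Heq. set (c := fun k => coef f k - coef f0 k).
    destruct (exists_sparse_approximation (coef f) q s n Hq Hs) as (b1 & Hb1 & Hr1); [apply Hf|].
    destruct (exists_sparse_approximation (coef f0) q s n Hq Hs) as (b2 & Hb2 & Hr2); [apply Hf0|].
    set (B := Rpower s (1 - / q)) in *. set (B2 := Rpower s (/ 2 - / q)).
    set (V := nu q alpha f + nu q alpha f0).
    assert (HV : 0 <= V) by (unfold V; pose proof (nu_nonneg q alpha Halpha f Hf);
      pose proof (nu_nonneg q alpha Halpha f0 Hf0); lra).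
    assert (HB : 0 < B) by apply Rpower_pos. assert (HB2 : 0 < B2) by apply Rpower_pos.
    (* [f] and [f0] are each nearly [s]-sparse, so their difference is nearly [2s]-sparse on the
       union. *)
    set (big := fun k => b1 k \/ b2 k).
    assert (Hbig : forall k, indic (big k) <= indic (b1 k) + indic (b2 k) /\
              1 - indic (big k) <= 1 - indic (b1 k) /\ 1 - indic (big k) <= 1 - indic (b2 k)).
    { intros k. unfold indic, big. repeat destruct excluded_middle_informative; try tauto; lra. }
    assert (Hxs : xs <> nil).
    { intros ->. simpl in Hlen. pose proof (Nat.pow_nonzero 2 J). nia. }
    pose proof (robust_null_space wleg n xs J s c big (sqrt 3 * V * B2) Hxs ltac:(lra) HJ) as Hnsp.
    assert (Hmain : l1 n c <= 2 * lsum (seq 0 n) (fun k => Rabs (c k) * (1 - indic (big k)))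
                              + 32 * sqrt s * (sqrt 3 * V * B2)).
    { apply Hnsp.
      - repeat apply Rmult_le_pos; try lra. apply sqrt_pos.
      - eapply Rle_trans; [|apply (Hlow c)]. specialize (Hframe c). lra.
      - apply Rle_trans with (lsum (seq 0 n) (fun k => indic (b1 k) + indic (b2 k))).
        + apply lsum_le; intros; apply Hbig.
        + rewrite lsum_plus. lra.
      - intros x Hx. exact (sample_mismatch_le D f f0 x HD Hf Hf0 (HOm1 x (Hincl x Hx)) (Heq x Hx)). }
    assert (Hsig : lsum (seq 0 n) (fun k => Rabs (c k) * (1 - indic (big k))) <= V * B).
    { apply Rle_trans with (lsum (seq 0 n) (fun k => Rabs (coef f k) * (1 - indic (b1 k))
                                + Rabs (coef f0 k) * (1 - indic (b2 k)))).
      - apply lsum_le; intros k _. destruct (Hbig k) as (_ & Hk1 & Hk2).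
        pose proof (indic_bounds (big k)) as Hk.
        assert (Hck : Rabs (c k) <= Rabs (coef f k) + Rabs (coef f0 k)).
        { unfold c, Rminus. eapply Rle_trans; [apply Rabs_triang|]. rewrite Rabs_Ropp. lra. }
        pose proof (Rabs_pos (coef f k)). pose proof (Rabs_pos (coef f0 k)). nra.
      - rewrite lsum_plus. fold (norm_Ap q f) in Hr1. fold (norm_Ap q f0) in Hr2.
        unfold V, nu.
        assert (0 <= norm_A1alpha alpha f).
        { apply Series_nonneg; [apply Hf|]. intros; apply A1alpha_term_nonneg. }
        assert (0 <= norm_A1alpha alpha f0).
        { apply Series_nonneg; [apply Hf0|]. intros; apply A1alpha_term_nonneg. }
        nra. }
    (* [32 * sqrt 3 <= 64]; with the 2 in front of the sparse error this gives [K = 66]. *)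
    assert (Hnoise : 32 * sqrt s * (sqrt 3 * V * B2) <= 64 * (V * B)).
    { replace (32 * sqrt s * (sqrt 3 * V * B2)) with (32 * sqrt 3 * (V * (sqrt s * B2))) by ring.
      unfold B2. rewrite sqrt_mul_Rpower. fold B. pose proof sqrt3_le_2.
      assert (0 <= V * B) by (apply Rmult_le_pos; lra). nra. }
    fold n V. lra.
Qed.

End Stability.

(** * Counting the samples and fixing the constants *)

Lemma ln_2_bounds : / 2 < ln 2 <= 1.
Proof.
  split; [apply ln_lt_2|]. rewrite <- (ln_exp 1). apply ln_le; [lra|].
  pose proof (exp_ineq1_le 1). lra.
Qed.

Lemma exists_pow2_between n : (2 <= n)%nat ->
  exists h, (n <= 2 ^ h)%nat /\ (2 ^ h <= 2 * n)%nat /\ INR h <= 2 * ln (2 * INR n).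
Proof.
  intros Hn. exists (Nat.log2_up n). destruct (Nat.log2_up_spec n) as [H1 H2]; [lia|].
  assert (H3 : (2 ^ Nat.log2_up n <= 2 * n)%nat).
  { assert (Hp : (0 < Nat.log2_up n)%nat) by (apply Nat.log2_up_pos; lia).
    destruct (Nat.log2_up n); [lia|]. simpl in *. lia. }
  split; [lia|split; [exact H3|]].
  apply le_INR in H3. rewrite pow_INR_2, mult_INR in H3. simpl (INR 2) in H3.
  set (h := Nat.log2_up n) in *.
  assert (H4 : INR h * ln 2 <= ln (2 * INR n)).
  { rewrite <- ln_pow by lra. apply ln_le; [apply pow_lt; lra|]. lra. }
  pose proof ln_2_bounds. pose proof (pos_INR h). nra.
Qed.

(** [2^J (J+2)] is of order [s log s], and [h (J+2)] of order [lam log s], where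
    [lam = beta * ln s]. The assumption [s^beta > 2] keeps [lam] away from zero, so that additive
    constants are absorbed. *)
Lemma sample_count_bound (q alpha s : R) (m N sn : nat) :
  let beta := (/ q - / 2) / alpha in
  s = INR sn -> (2 <= sn)%nat -> 2 < Rpower s beta -> INR N - 1 < Rpower s beta ->
  10 ^ 11 * beta * s * ln s ^ 4 <= INR m ->
  exists J h, 1024 * s <= 2 ^ J /\ (2 * S N <= 2 ^ h)%nat /\
    (2 * 2 ^ J * (J + 2) * (1024 * h * (J + 2) + 1) <= m)%nat.
Proof.
  intros beta Hs Hsn Hb HN Hm.
  assert (Hs2 : 2 <= s) by (rewrite Hs; apply le_INR in Hsn; exact Hsn).
  pose proof ln_2_bounds as Hln2.
  set (ell := ln s) in *. set (lam := beta * ell).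
  assert (Hell : ln 2 <= ell) by (apply ln_le; lra).
  assert (Hlam : Rpower s beta = exp lam) by reflexivity.
  assert (Hlam2 : ln 2 < lam).
  { apply exp_lt_inv. rewrite exp_ln by lra. rewrite <- Hlam. exact Hb. }
  destruct (exists_pow2_between sn Hsn) as (e & He1 & He2 & He3).
  destruct (exists_pow2_between (2 * S N) ltac:(lia)) as (h & Hh1 & _ & Hh2).
  apply le_INR in He1, He2. rewrite mult_INR, pow_INR_2 in He2. rewrite pow_INR_2 in He1.
  change (INR 2) with 2 in He2. rewrite <- Hs in *.
  rewrite ln_mult in He3 by lra. fold ell in He3.
  (* [2^10 = 1024] is the constant of the null space estimate; [2^J] lies between [1024 s] and
     [2048 s]. *)
  exists (e + 10)%nat, h.
  assert (HJ : 2 ^ (e + 10) = 1024 * 2 ^ e) by (rewrite pow_add; simpl; ring).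
  repeat split; auto; [lra|].
  (* [4 (N+1) <= 4 (X+2) <= X^4] for [X = s^beta > 2]. *)
  assert (Hh : INR h <= 8 * lam).
  { eapply Rle_trans; [exact Hh2|].
    assert (HlnN : ln (2 * INR (2 * S N)) <= 4 * lam).
    { replace (4 * lam) with (ln (exp lam ^ 4)).
      2:{ rewrite ln_pow by apply exp_pos. rewrite ln_exp. simpl; ring. }
      rewrite Hlam in *. set (X := exp lam) in *.
      rewrite mult_INR, (S_INR N). simpl (INR 2).
      assert (0 <= INR N) by apply pos_INR.
      apply ln_le; [lra|]. assert (4 <= X ^ 2) by nra.
      replace (X ^ 4) with (X ^ 2 * X ^ 2) by ring.
      assert (2 * X <= X ^ 2) by nra. assert (4 * X ^ 2 <= X ^ 2 * X ^ 2) by nra. lra. }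
    lra. }
  apply INR_le. rewrite !mult_INR, !plus_INR, !mult_INR, !plus_INR, pow_INR_2, HJ.
  rewrite (INR_IZR_INZ 1024), (INR_IZR_INZ 10).
  change (INR 2) with 2. change (INR 1) with 1.
  change (IZR (Z.of_nat 1024)) with 1024. change (IZR (Z.of_nat 10)) with 10.
  eapply Rle_trans; [|exact Hm].
  set (J2 := INR e + 10 + 2).
  (* [e <= 4 * ell] and [12 <= 24 * ell], as [ell >= ln 2 > 1/2]. *)
  assert (HJ2 : 0 <= J2 <= 28 * ell) by (unfold J2; pose proof (pos_INR e); lra).
  assert (Hprod : / 4 < lam * ell) by nra.
  pose proof (pos_INR h).
  assert (H1 : 1024 * INR h * J2 + 1 <= 229380 * (lam * ell)).
  { assert (INR h * J2 <= 8 * lam * (28 * ell)) by (apply Rmult_le_compat; lra). lra. }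
  assert (H1p : 0 <= 1024 * INR h * J2) by (apply Rmult_le_pos; lra).
  assert (H2 : 2 * (1024 * 2 ^ e) * J2 <= 4096 * s * (28 * ell)).
  { assert (0 < 2 ^ e) by (apply pow_lt; lra). apply Rmult_le_compat; lra. }
  apply Rle_trans with (4096 * s * (28 * ell) * (229380 * (lam * ell))).
  - apply Rmult_le_compat; try lra. assert (0 < 2 ^ e) by (apply pow_lt; lra).
    apply Rmult_le_pos; lra.
  (* [26307133440 = 4096 * 28 * 229380] is below [10^11 * ell], because [ell > 1/2]. *)
  - replace (10 ^ 11 * beta * s * ell ^ 4) with (10 ^ 11 * ell * (s * ell ^ 2 * lam)) by (unfold lam; ring).
    replace (4096 * s * (28 * ell) * (229380 * (lam * ell)))
      with (26307133440 * (s * ell ^ 2 * lam)) by ring.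
    apply Rmult_le_compat_r.
    + apply Rmult_le_pos; [apply Rmult_le_pos; [lra|apply pow2_ge_0]|lra].
    + lra.
Qed.

(** More samples only restrict the pairs to be compared; in the small cases the sample is padded to
    length [m] by repeating 0. *)
Lemma stable_incl q alpha D xs ys K B : incl xs ys -> stable q alpha D xs K B -> stable q alpha D ys K B.
Proof. intros Hi [H1 H2]. split; auto. Qed.

Theorem theorem7p2 :
  exists C C' : R, 0 < C /\ 0 < C' /\
  forall (q alpha : R) (m s N : nat),
    0 < q < 1 -> 0 < alpha -> (1 <= s)%nat ->
    INR m >= C * / alpha * (/ q - / 2) * INR s * (ln (INR s)) ^ 4 ->
    (* N = ceil (s^((1/q - 1/2)/alpha)) *)
    INR N - 1 < Rpower (INR s) ((/ q - / 2) / alpha) <= INR N ->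
    exists (xs : list R) (Rec : list R -> nat -> R),
      length xs = m /\ (forall x, In x xs -> -1 <= x <= 1) /\
      forall f : R -> R, in_Ap q f -> in_A1alpha alpha f ->
        let P := poly_eval N (Rec (map f xs)) in
        let g := fun x => f x - P x in
        ex_series (fun k => Rabs (coef g k)) /\
        Rbar_le (Rbar_mult (Finite (/ sqrt 3)) (norm_inf_w g)) (Finite (norm_A1 g)) /\
        norm_A1 g <= C' * (norm_Ap q f + norm_A1alpha alpha f)
                       * Rpower (INR s) (1 - / q).
Proof.
  (* [199 = 3 * 66 + 1] comes from [recovery_of_stable], and [10^11] absorbs the constants of
     [sample_count_bound]. *)
  exists (10 ^ 11), 199. split; [lra|split; [lra|]].
  intros q alpha m s N Hq Halpha Hs Hm HN.
  set (beta := (/ q - / 2) / alpha) in *.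
  assert (Hs1 : 1 <= INR s) by (apply le_INR in Hs; exact Hs).
  assert (Hgoal : exists D xs, (D <= N)%nat /\ length xs = m /\ (forall x, In x xs -> -1 <= x <= 1) /\
            stable q alpha D xs 66 (Rpower (INR s) (1 - / q))).
  { assert (Hrep : forall x, In x (repeat 0 m) -> -1 <= x <= 1).
    { intros x Hx. apply repeat_spec in Hx. lra. }
    destruct (Nat.eq_dec s 1) as [E|E].
    - exists 0%nat, (repeat 0 m).
      split; [lia|split; [apply repeat_length|split; [exact Hrep|]]].
      apply (stable_incl q alpha 0 nil); [apply incl_nil_l|].
      apply stable_no_sample; auto. rewrite E; reflexivity.
    - assert (Hqinv : 1 < / q) by (rewrite <- Rinv_1; apply Rinv_lt_contravar; lra).
      assert (Hbeta : 0 < beta) by (unfold beta; apply Rdiv_lt_0_compat; lra).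
      assert (Hs2 : 2 <= INR s) by (assert (H : (2 <= s)%nat) by lia; apply le_INR in H; exact H).
      assert (Hlns : 0 < ln (INR s)) by (rewrite <- ln_1; apply ln_increasing; lra).
      assert (Hm' : 10 ^ 11 * beta * INR s * ln (INR s) ^ 4 <= INR m).
      { replace (10 ^ 11 * beta * INR s * ln (INR s) ^ 4)
          with (10 ^ 11 * / alpha * (/ q - / 2) * INR s * ln (INR s) ^ 4) by (unfold beta; field; lra). lra. }
      destruct (Rle_dec (Rpower (INR s) beta) 2) as [Hsmall|Hlarge].
      + assert (Hm0 : 0 < INR m).
        { eapply Rlt_le_trans; [|exact Hm']. assert (0 < 10 ^ 11 * beta * INR s) by (apply Rmult_lt_0_compat; [apply Rmult_lt_0_compat|]; lra).
          apply Rmult_lt_0_compat; [auto|now apply pow_lt]. }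
        assert (Hm1 : (0 < m)%nat) by (apply INR_lt; exact Hm0).
        exists 0%nat, (repeat 0 m).
        split; [lia|split; [apply repeat_length|split; [exact Hrep|]]].
        apply (stable_incl q alpha 0 (0 :: nil)); [intros x [<-|[]]; destruct m; [lia|now left]|].
        apply stable_center_sample; auto.
      + destruct (sample_count_bound q alpha (INR s) m N s eq_refl ltac:(lia)) as (J & h & HJ & Hh & Hcnt).
        * fold beta; lra.
        * fold beta; lra.
        * exact Hm'.
        * destruct (exists_stable_sample q alpha (INR s) Hq Halpha Hs1 N J h m) as (xs & Hx1 & Hx2 & Hx3); auto.
          -- fold beta; lra.
          -- exists N, xs. auto. }
  destruct Hgoal as (D & xs & HD & Hlen & Hxs & Hst).
  destruct (recovery_of_stable q alpha Hq Halpha D N xs 66 (Rpower (INR s) (1 - / q)) HD ltac:(lra)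
    ltac:(left; apply Rpower_pos) Hxs Hst) as [Rec HRec].
  exists xs, Rec. repeat split; auto; try (apply Hxs; auto).
  - apply (HRec f); auto.
  - apply (HRec f); auto.
  - destruct (HRec f H H0) as (_ & _ & Hbound). eapply Rle_trans; [exact Hbound|].
    unfold nu. right; ring.
Qed.
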